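(* Let $V$ be a real Banach space, $\Phi \in \mathcal{C}^1(V,\mathbb{R})$, $S\subset V$ a closed subset, and $Q\subset V$ a subset with relative boundary $\partial Q$. Let $\Gamma$ be one of the following five sets: \begin{itemize} \item $\Gamma_1=\{\gamma\in\mathcal{C}(V,V) : \gamma|_{\partial Q}=\mathrm{Id}\}$; \item $\Gamma_2=\{\gamma: V\to V \text{ compact} : \gamma|_{\partial Q}=\mathrm{Id}\}$; \item $\Gamma_3=\{\gamma: V\to V \text{ homeomorphism} : \gamma|_{\partial Q}=\mathrm{Id}\}$; \item $\Gamma_4=\{\gamma: V\to V \text{ compact} : \gamma \text{ maps every closed set onto a closed set, and } \gamma|_{\partial Q}=\mathrm{Id}\}$; \item $\Gamma_5=\{\gamma\in\Gamma_1 : \gamma(B) \text{ is compact for every closed bounded set } B\subset V\}$. \end{itemize} Suppose that: (a) $S$ and $\partial Q$ link with respect to $\Gamma$; (b) there exists $\alpha\in\mathbb{R}$ such that $\Phi(u)\le\alpha$ for all $u\in\partial Q$ and $\Phi(u)\ge\alpha$ for all $u\in S$; (c) there exists $\gamma_0\in\Gamma$ such that $\sup_{u\in Q}\Phi(\gamma_0(u))<\infty$. Let $$c_\Gamma=\inf_{\gamma\in\Gamma}\sup_{u\in Q}\Phi(\gamma(u)).$$ If $\Phi$ satisfies $(\mathrm{P.S.})_{c_\Gamma}$, then $c_\Gamma$ is a critical value of $\Phi$ and $c_\Gamma\ge\alpha$. Moreover, if $c_\Gamma=\alpha$, then $\mathcal{K}_{c_\Gamma}\cap S\neq\varnothing$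.
   Context: Relative boundary: $\partial Q$ denotes the boundary of $Q$ relative to the closed affine subspace of $V$ spanned by $Q$ (e.g. if $V=V_1\oplus V_2$ and $Q$ is the closed ball of radius $R$ about $0$ in $V_2$, then $\partial Q=\{u\in V_2:\|u\|=R\}$). Linking: for a set $\Gamma\subset\mathcal{C}(V,V)$ of continuous maps, a closed set $S$ and $\partial Q$ are said to link with respect to $\Gamma$ if $S\cap\partial Q=\varnothing$ and, for every $\gamma\in\Gamma$ with $\gamma|_{\partial Q}=\mathrm{Id}$, one has $\gamma(Q)\cap S\ne\varnothing$. A map is compact if it is continuous and maps bounded sets into relatively compact sets. Palais-Smale condition at level $c$: $\Phi$ satisfies $(\mathrm{P.S.})_c$ if every sequence $(u_n)$ in $V$ with $\Phi(u_n)\to c$ and $\Phi'(u_n)\to0$ (in $V^*$) is precompact, i.e. has a convergent subsequence. $\mathcal{K}_c=\{v\in V:\Phi'(v)=0,\ \Phi(v)=c\}$; $c$ is a critical value if $\mathcal{K}_c\neq\varnothing$. *)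

(* Defs.v *)
From HB Require Import structures.
From mathcomp Require Export all_boot all_order all_algebra.
From mathcomp Require Export all_classical all_reals all_analysis.
Export Order.TTheory GRing.Theory Num.Theory.
Export numFieldNormedType.Exports.

Set Implicit Arguments.
Unset Strict Implicit.
Unset Printing Implicit Defensive.

Local Open Scope classical_set_scope.
Local Open Scope ring_scope.

Section RelativeBoundary.
Context {R : realType} {V : normedModType R}.

Definition affine_set (A : set V) : Prop :=
  forall (t : R) (x y : V), A x -> A y -> A ((1 - t) *: x + t *: y).

Definition closed_affine_hull (Q : set V) : set V :=
  \bigcap_(A in [set A : set V | [/\ affine_set A, closed A & Q `<=` A]]) A.

(* Points outside A are isolated in the library's topology on [subspace A];
   this is harmless below because Q is contained in its hull A. *)
Definition rel_boundary (Q : set V) : set V :=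
  let Q' : set (subspace (closed_affine_hull Q)) := Q in
  closure Q' `\` interior Q'.

End RelativeBoundary.

Section AdmissibleMaps.
Context {R : realType} {V : normedModType R}.

Definition compact_map (g : V -> V) : Prop :=
  continuous g /\
  forall B : set V, bounded_set B -> precompact (g @` B).

Definition homeomorphism (g : V -> V) : Prop :=
  continuous g /\
  exists h : V -> V, [/\ continuous h, cancel g h & cancel h g].

Definition fixes (A : set V) (g : V -> V) : Prop :=
  forall u, A u -> g u = u.

Definition Gamma1 (Q : set V) : set (V -> V) :=
  [set g | continuous g /\ fixes (rel_boundary Q) g].

Definition Gamma2 (Q : set V) : set (V -> V) :=
  [set g | compact_map g /\ fixes (rel_boundary Q) g].

Definition Gamma3 (Q : set V) : set (V -> V) :=
  [set g | homeomorphism g /\ fixes (rel_boundary Q) g].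

Definition Gamma4 (Q : set V) : set (V -> V) :=
  [set g | [/\ compact_map g,
               (forall A : set V, closed A -> closed (g @` A)) &
               fixes (rel_boundary Q) g]].

Definition Gamma5 (Q : set V) : set (V -> V) :=
  [set g | Gamma1 Q g /\
           forall B : set V, closed B -> bounded_set B -> compact (g @` B)].

Definition links (Gamma : set (V -> V)) (S Q : set V) : Prop :=
  S `&` rel_boundary Q = set0 /\
  forall g, Gamma g -> fixes (rel_boundary Q) g -> (g @` Q) `&` S !=set0.

End AdmissibleMaps.

Section CriticalPoints.
Context {R : realType} {V : normedModType R}.

(* The operator norm of V^*.  [sup] of an unbounded set is 0, so this is
   meaningful only for a continuous linear form l; differentials at points of
   differentiability (and their differences) are such forms. *)
Definition dual_norm (l : V -> R) : R :=
  sup [set `|l v| | v in [set v : V | `|v| <= 1]].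

Definition C1 (Phi : V -> R) : Prop :=
  (forall u, differentiable Phi u) /\
  (forall u, dual_norm (fun h => 'd Phi v h - 'd Phi u h) @[v --> u] --> 0).

Definition palais_smale (Phi : V -> R) (c : R) : Prop :=
  forall u : nat -> V,
    Phi (u n) @[n --> \oo] --> c ->
    dual_norm ('d Phi (u n)) @[n --> \oo] --> 0 ->
    exists2 s : nat -> nat, increasing_seq s & cvgn (u \o s).

Definition critical_points_at (Phi : V -> R) (c : R) : set V :=
  [set v | (forall h, 'd Phi v h = 0) /\ Phi v = c].

Definition critical_value (Phi : V -> R) (c : R) : Prop :=
  critical_points_at Phi c !=set0.

(* The suprema and the infimum are taken in the extended reals, since the
   supremum may be infinite for some of the maps. *)
Definition sup_along (Phi : V -> R) (Q : set V) (g : V -> V) : \bar R :=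
  ereal_sup [set (Phi (g u))%:E | u in Q].

Definition minimax (Phi : V -> R) (Q : set V) (Gamma : set (V -> V)) : \bar R :=
  ereal_inf [set sup_along Phi Q g | g in Gamma].

End CriticalPoints.

(* Main.v *)
(* Euler polygons give a semiflow for every bounded Lipschitz field.  A locally
   Lipschitz pseudo-gradient of Phi need not be globally Lipschitz, so it is
   written as a quotient W / r of globally Lipschitz maps with |W| <= r and r > 0
   (Stone's covering construction with weights 2^-n), and W / r is followed up to
   time tau by following (W, r) in V x R from the level 0 to the level tau; the
   last coordinate bounds the length of the orbits, so the levels are reached
   (V is complete), depend continuously on the initial point, and the reversed
   flow gives the inverse homeomorphism.

   S and the relative boundary B of Q may be at distance zero.  They are kept
   apart by the set T of the points u near S with b + k/2 |u - s| <= Phi u for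
   some s in S: orbits issued from S stay in T while Phi is below b + r0, and T is
   disjoint from B since Phi <= b on B.  Hence the field can be made to vanish on
   B, and its flow lifts S above the level b + eps.  The inverse eta of this
   homeomorphism preserves each of the five classes, so gamma(Q) reaches the level
   b + eps for every admissible gamma.  This contradicts the definition of c, with
   b = c when c = alpha, and with b slightly below c and {Phi >= b} in place of S
   when c > alpha. *)
Require Import Defs.
From mathcomp Require Import wochoice ring lra.
Set Implicit Arguments.
Unset Strict Implicit.
Unset Printing Implicit Defensive.
Local Open Scope classical_set_scope.
Local Open Scope ring_scope.

(** * Euler semiflows of bounded Lipschitz fields *)

Section Euler.
Context {R : realType} {E : normedModType R}.
Implicit Types (F P Q : E -> E) (x y : E) (h t : R).

Definition euler F h x : E := x + h *: F x.

(** Discrete Gronwall estimate: each of the [n] steps adds an error [e], and later steps amplify it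
    by at most [K ^+ n]. *)
Lemma iter_close P Q (K e : R) n x y : 1 <= K -> 0 <= e ->
  (forall u v, `|Q u - Q v| <= K * `|u - v|) ->
  (forall u, `|P u - Q u| <= e) ->
  `|iter n P x - iter n Q y| <= K ^+ n * (`|x - y| + e *+ n).
Proof.
move=> K1 e0 QK PQ; elim: n => [|n IH]; first by rewrite expr0 mul1r mulr0n addr0.
rewrite !iterS; set u := iter n P x in IH *; set v := iter n Q y in IH *.
rewrite (_ : P u - Q v = (P u - Q u) + (Q u - Q v)); last by rewrite addrA subrK.
apply: (le_trans (ler_normD _ _)).
have Kn : e <= K ^+ n.+1 * e by rewrite ler_peMl // exprn_ege1.
have := PQ u; have := QK u v.
have : K * `|u - v| <= K * (K ^+ n * (`|x - y| + e *+ n)).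
  by rewrite ler_wpM2l // (le_trans _ K1).
rewrite mulrSr addrA [K ^+ n.+1 * (_ + e)]mulrDr exprS; rewrite exprS in Kn.
by rewrite !mulrA; lra.
Qed.

(** The innermost pair [P (Q z)], with [z = iter n Q x], is replaced by [z] at cost [e], which the
    remaining [n] applications of [P] amplify by at most [K ^+ n]. *)
Lemma iter_inverse P Q (K e : R) n x : 1 <= K -> 0 <= e ->
  (forall u v, `|P u - P v| <= K * `|u - v|) ->
  (forall u, `|P (Q u) - u| <= e) ->
  `|iter n P (iter n Q x) - x| <= K ^+ n * (e *+ n).
Proof.
move=> K1 e0 PK PQ; elim: n => [|n IH]; first by rewrite mulr0n mulr0 subrr normr0.
rewrite iterSr [iter n.+1 Q x]iterS; set z := iter n Q x in IH *.
rewrite -(subrK (iter n P z) (iter n P (P (Q z)))) -addrA.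
apply: (le_trans (ler_normD _ _)).
have PP u : `|P u - P u| <= 0 by rewrite subrr normr0.
have H1 := iter_close n (P (Q z)) z K1 (lexx 0) PK PP.
rewrite mul0rn addr0 in H1.
have H2 : K ^+ n * `|P (Q z) - z| <= K ^+ n * e.
  by rewrite ler_wpM2l // exprn_ge0 // (le_trans _ K1).
have H3 : K ^+ n * (e *+ n.+1) <= K ^+ n.+1 * (e *+ n.+1).
  by rewrite ler_wpM2r ?mulrn_wge0 // ler_weXn2l.
apply: le_trans H3; rewrite mulrSr mulrDr; lra.
Qed.

Section LipschitzBounded.
Variables (F : E -> E) (L M : R).
Hypotheses (L0 : 0 <= L) (FL : forall x y, `|F x - F y| <= L * `|x - y|)
  (FM : forall x, `|F x| <= M).

Lemma bound_ge0 : 0 <= M. Proof. exact: le_trans (FM 0). Qed.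

Lemma euler_lipschitz h x y : 0 <= h ->
  `|euler F h x - euler F h y| <= (1 + L * h) * `|x - y|.
Proof.
move=> h0; rewrite /euler opprD addrACA -scalerBr.
apply: (le_trans (ler_normD _ _)); rewrite normrZ ger0_norm //.
have := ler_wpM2l h0 (FL x y); lra.
Qed.

Lemma iter_euler_drift h n x : 0 <= h ->
  `|iter n (euler F h) x - x| <= (h *+ n) * M.
Proof.
move=> h0; elim: n => [|n IH]; first by rewrite subrr normr0 mulr0n mul0r.
rewrite iterS {1}/euler addrAC; apply: (le_trans (ler_normD _ _)).
rewrite normrZ ger0_norm // mulrSr mulrDl.
by apply: lerD => //; rewrite ler_wpM2l.
Qed.

(** After time [s] the iterate has drifted by at most [s * M], so the next step deviates from
    [h *: F x] by at most [h * L * s * M]; these errors add up to a quadratic term. *)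
Lemma iter_euler_expansion h n x : 0 <= h ->
  `|iter n (euler F h) x - (x + (h *+ n) *: F x)| <= L * M * (h *+ n) ^+ 2.
Proof.
move=> h0; have M0 := bound_ge0.
elim: n => [|n IH].
  by rewrite mulr0n scale0r addr0 subrr normr0 expr0n mulr0.
rewrite iterS {1}/euler; set u := iter n _ x in IH *.
rewrite mulrSr scalerDl.
have -> : u + h *: F u - (x + ((h *+ n) *: F x + h *: F x)) =
  (u - (x + (h *+ n) *: F x)) + h *: (F u - F x).
  by rewrite scalerBr [x + (_ + _)]addrA opprD addrACA.
apply: (le_trans (ler_normD _ _)); rewrite normrZ ger0_norm //.
have H1 := iter_euler_drift n x h0.
have H2 : h * `|F u - F x| <= h * (L * (h *+ n * M)).
  rewrite ler_wpM2l //; apply: (le_trans (FL u x)); rewrite ler_wpM2l //.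
have s0 : 0 <= h *+ n by rewrite mulrn_wge0.
set s := h *+ n in IH H2 s0 *.
have P1 : 0 <= h * (L * (s * M)) by rewrite !mulr_ge0.
have P2 : 0 <= L * M * (h ^+ 2) by rewrite !mulr_ge0 // sqr_ge0.
have -> : L * M * (s + h) ^+ 2 = L * M * s ^+ 2 + 2 * (h * (L * (s * M))) + L * M * h ^+ 2.
  by ring.
lra.
Qed.

(** The local error of refining one step is quadratic in [h]; summed over about [t / h] steps it is
    linear in [h], which makes the dyadic polygons converge. *)
Lemma euler_halving h x : 0 <= h ->
  `|euler F h (euler F h x) - euler F (h * 2) x| <= L * M * h ^+ 2.
Proof.
move=> h0.
rewrite /euler -/(euler F h x); set y := euler F h x.
have -> : y + h *: F y - (x + (h * 2) *: F x) = h *: (F y - F x).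
  rewrite mulr_natr mulr2n scalerDl [x + (_ + _)]addrA -/(euler F h x) -/y.
  by rewrite opprD addrACA subrr add0r scalerBr.
rewrite normrZ ger0_norm // {}/y.
have : `|euler F h x - x| <= h * M.
  by rewrite /euler addrC addKr normrZ ger0_norm // ler_wpM2l.
move=> H; have := FL (euler F h x) x; have := ler_wpM2l L0 H => H1 H2.
have := ler_wpM2l h0 (le_trans H2 H1); rewrite expr2; lra.
Qed.

Lemma euler_reverse h x : 0 <= h ->
  `|euler (fun z => - F z) h (euler F h x) - x| <= L * M * h ^+ 2.
Proof.
move=> h0; rewrite {1}/euler scalerN.
have -> : euler F h x - h *: F (euler F h x) - x = - (h *: (F (euler F h x) - F x)).
  by rewrite scalerBr opprB {1}/euler addrAC [x + _]addrC addrK.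
rewrite normrN normrZ ger0_norm //.
have : `|euler F h x - x| <= h * M.
  by rewrite /euler addrC addKr normrZ ger0_norm // ler_wpM2l.
move=> H; have := FL (euler F h x) x; have := ler_wpM2l L0 H => H1 H2.
have := ler_wpM2l h0 (le_trans H2 H1); rewrite expr2; lra.
Qed.

Lemma one_plus_exp_le h n t : 0 <= h -> h *+ n <= t ->
  (1 + L * h) ^+ n <= expR (L * t).
Proof.
move=> h0 hn; have Lh : 0 <= L * h by rewrite mulr_ge0.
apply: (@le_trans _ _ (expR (L * h) ^+ n)).
  by rewrite lerXn2r ?nnegrE ?expR_ge0 ?addr_ge0 // expR_ge1Dx.
by rewrite -expRM_natl ler_expR mulr_natl -mulrnAr ler_wpM2l.
Qed.

End LipschitzBounded.
End Euler.

(** This sequential form passes to [V * R^o] coordinate by coordinate. *)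
Definition seq_complete (R : realType) (E : normedModType R) :=
  forall u : nat -> E,
    (forall e : R, 0 < e ->
      exists N, forall m, (N <= m)%N -> `|u m - u N| <= e) ->
    exists l : E, u n @[n --> \oo] --> l.

Section Limits.
Context {R : realType} {E : normedModType R}.

Lemma cvg_norm_le (u v : nat -> E) (r : nat -> R) (l m : E) (s : R) :
  u n @[n --> \oo] --> l -> v n @[n --> \oo] --> m ->
  r n @[n --> \oo] --> s ->
  (forall n, `|u n - v n| <= r n) -> `|l - m| <= s.
Proof.
move=> ul vm rs uvr.
apply: (ler_cvg_to (cvg_norm (cvgB ul vm)) rs).
by apply: nearW => n; exact: uvr.
Qed.

Lemma cvg_half_expr : (2^-1 : R) ^+ n @[n --> \oo] --> (0 : R).
Proof. by apply: cvg_expr; rewrite ger0_norm //; lra. Qed.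

Lemma small_half_expr (C e : R) : 0 < e -> exists N, C * 2^-1 ^+ N <= e.
Proof.
move=> e0.
have : C * 2^-1 ^+ n @[n --> \oo] --> C * 0.
  by apply: cvgM; [exact: cvg_cst | exact: cvg_half_expr].
rewrite mulr0 => /cvgrPdist_le /(_ e e0) [N _ /(_ N (leqnn N))] /=.
by rewrite sub0r normrN => /(le_trans (ler_norm _)) ?; exists N.
Qed.

Lemma cvg_geometric_steps (u : nat -> E) (C : R) : seq_complete E ->
  (forall k, `|u k.+1 - u k| <= C * 2^-1 ^+ k) ->
  exists l : E, u n @[n --> \oo] --> l.
Proof.
move=> cE uC; apply: cE => e e0.
have [N Ne] := small_half_expr (2 * C) e0; exists N => m Nm.
rewrite -(subnKC Nm); move: (m - N)%N => d.
(* The exact geometric remainder is kept so that the induction on [d] closes. *)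
have H : `|u (N + d)%N - u N| <= 2 * C * 2^-1 ^+ N - 2 * C * 2^-1 ^+ (N + d).
  elim: d => [|j IH]; first by rewrite addn0 !subrr normr0.
  rewrite addnS -(subrK (u (N + j)%N) (u (N + j).+1)) -addrA.
  apply: (le_trans (ler_normD _ _)); have := uC (N + j)%N.
  rewrite exprS; lra.
apply: (le_trans H); apply: le_trans _ Ne.
have := le_trans (normr_ge0 _) (uC (N + d)%N); lra.
Qed.

End Limits.

Section Semiflow.
Context {R : realType} {E : normedModType R}.
Implicit Types (F : E -> E) (phi : R -> E -> E) (x y : E) (s t : R).

(** Only whole steps of length [2^-k] are made, so the time reached falls short of [t] by at most
    one step; each refinement halves the step. *)
Definition polygon F (k : nat) t : E -> E :=
  iter (Num.truncn (t * 2 ^+ k)) (euler F (2^-1 ^+ k)).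

(* Only times [t >= 0] are constrained. *)
Definition semiflow F phi :=
  forall t x, 0 <= t -> polygon F k t x @[k --> \oo] --> phi t x.

Lemma half_expr_gt0 k : 0 < 2^-1 ^+ k :> R.
Proof. by rewrite exprn_gt0 // invr_gt0. Qed.

Lemma half_expr_ge0 k : 0 <= 2^-1 ^+ k :> R. Proof. exact/ltW/half_expr_gt0. Qed.

Lemma half_exprK k : 2 ^+ k * 2^-1 ^+ k = 1 :> R.
Proof. by rewrite -exprMn divff ?expr1n // pnatr_eq0. Qed.

Lemma polygon_time t k : 0 <= t ->
  t - 2^-1 ^+ k <= 2^-1 ^+ k *+ Num.truncn (t * 2 ^+ k) <= t.
Proof.
move=> t0; have tk : 0 <= t * 2 ^+ k by rewrite mulr_ge0 // exprn_ge0.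
have /andP[a b] := truncn_itv tk; have h := half_expr_ge0 k; have e := half_exprK k.
have := ler_wpM2r h a; have := ler_wpM2r h (ltW b).
rewrite -mulrA e mulr1 -natr1 mulrDl mul1r -[_ *+ _]mulr_natl => h1 h2.
by apply/andP; split; lra.
Qed.

Section LipschitzBounded.
Variables (F : E -> E) (L M : R).
Hypotheses (L0 : 0 <= L) (FL : forall x y, `|F x - F y| <= L * `|x - y|)
  (FM : forall x, `|F x| <= M).

Let M0 : 0 <= M. Proof. exact: bound_ge0 FM. Qed.

Lemma polygon_lipschitz k t x y : 0 <= t ->
  `|polygon F k t x - polygon F k t y| <= expR (L * t) * `|x - y|.
Proof.
move=> t0; have h := half_expr_ge0 k.
have K1 : 1 <= 1 + L * 2^-1 ^+ k by rewrite lerDl mulr_ge0.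
have FF u : `|euler F (2^-1 ^+ k) u - euler F (2^-1 ^+ k) u| <= 0.
  by rewrite subrr normr0.
have := iter_close (Num.truncn (t * 2 ^+ k)) x y K1 (lexx 0)
  (fun u v => euler_lipschitz FL u v h) FF.
rewrite mul0rn addr0 => /le_trans; apply; rewrite ler_wpM2r //.
by apply: one_plus_exp_le => //; have /andP[] := polygon_time k t0.
Qed.

(** The [n] coarse steps are compared with [2 n] fine ones by [iter_close] and [euler_halving]; a
    possible odd fine step costs at most [M] times its length. *)
Lemma polygon_step k t x : 0 <= t ->
  `|polygon F k.+1 t x - polygon F k t x|
    <= (expR (L * t) * L * M * t + M) * 2^-1 ^+ k.
Proof.
move=> t0; rewrite /polygon.
set h := 2^-1 ^+ k.+1; set h' := 2^-1 ^+ k.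
have h0 : 0 <= h by exact: half_expr_ge0.
have hh : h' = h * 2 by rewrite /h /h' exprSr mulfVK.
set n := Num.truncn (t * 2 ^+ k).
have [b bn] : exists2 b, Num.truncn (t * 2 ^+ k.+1) = (b + n * 2)%N & (b <= 1)%N.
  have tk : 0 <= t * 2 ^+ k by rewrite mulr_ge0 // exprn_ge0.
  have /andP[a1 b1] := truncn_itv tk.
  have tk' : 0 <= t * 2 ^+ k.+1 by rewrite mulr_ge0 // exprn_ge0.
  have a2 : (n * 2 <= Num.truncn (t * 2 ^+ k.+1))%N.
    by rewrite truncn_ge_nat // natrM exprSr mulrA ler_wpM2r.
  have b2 : (Num.truncn (t * 2 ^+ k.+1) < n.+1 * 2)%N.
    by rewrite truncn_lt_nat // natrM exprSr mulrA ltr_pM2r.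
  exists (Num.truncn (t * 2 ^+ k.+1) - n * 2)%N; first by rewrite subnK.
  by move: b2; rewrite mulSn addnC -ltn_subLR // => b2; rewrite -ltnS.
move=> b1; rewrite bn iterD iterM.
set y := iter n (iter 2 _) x.
rewrite -(subrK y (iter b _ y)) -addrA.
apply: (le_trans (ler_normD _ _)).
have D := iter_euler_drift FM b y h0.
have D1 : h *+ b * M <= M * h'.
  rewrite mulrC ler_wpM2l // hh mulr_natr.
  by rewrite ler_wpMn2l // (leq_trans b1).
have K1 : 1 <= 1 + L * h' by rewrite lerDl mulr_ge0 // half_expr_ge0.
have e0 : 0 <= L * M * h ^+ 2 by rewrite !mulr_ge0 // sqr_ge0.
have C : `|y - iter n (euler F h') x| <= (1 + L * h') ^+ n * (`|x - x| + (L * M * h ^+ 2) *+ n).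
  apply: iter_close => //.
    by move=> u v; apply: euler_lipschitz => //; exact: half_expr_ge0.
  by move=> u; rewrite hh; exact: euler_halving.
rewrite subrr normr0 add0r in C.
have nt : h' *+ n <= t by have /andP[] := polygon_time k t0.
have X := one_plus_exp_le L0 (half_expr_ge0 k) nt.
have C1 : (1 + L * h') ^+ n * (L * M * h ^+ 2 *+ n) <= expR (L * t) * L * M * t * h'.
  rewrite -!mulrA; apply: ler_pM => //.
  - by rewrite exprn_ge0 // (le_trans _ K1).
  - by rewrite mulrn_wge0 // mulrA.
  rewrite -!mulrnAr ler_wpM2l // ler_wpM2l // mulrC.
  apply: ler_pM => //; first by rewrite mulrn_wge0.
    by apply: le_trans nt; rewrite hh -mulrnAl ler_peMr ?mulrn_wge0 // ler1n.
  by rewrite hh ler_peMr // ler1n.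
by lra.
Qed.

Lemma semiflow_exists : seq_complete E -> exists phi, semiflow F phi.
Proof.
move=> cE.
have H (p : R * E) : exists l : E, 0 <= p.1 -> polygon F k p.1 p.2 @[k --> \oo] --> l.
  have [t0|t0] := leP 0 p.1; last by exists 0.
  have [l lP] := cvg_geometric_steps cE (fun k => polygon_step k p.2 t0).
  by exists l.
have [f fP] := choice H.
by exists (fun t x => f (t, x)) => t x; exact: (fP (t, x)).
Qed.

Variable phi : R -> E -> E.
Hypothesis phiP : semiflow F phi.

Lemma semiflow_lipschitz t x y : 0 <= t ->
  `|phi t x - phi t y| <= expR (L * t) * `|x - y|.
Proof.
move=> t0; apply: (cvg_norm_le (@phiP t x t0) (@phiP t y t0) (cvg_cst _)).
by move=> k; exact: polygon_lipschitz.
Qed.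

Lemma semiflow_expansion t x : 0 <= t ->
  `|phi t x - (x + t *: F x)| <= L * M * t ^+ 2.
Proof.
move=> t0.
have r : L * M * t ^+ 2 + M * 2^-1 ^+ n @[n --> \oo] --> L * M * t ^+ 2.
  rewrite -[X in _ --> X]addr0 -[X in _ + X](mulr0 M).
  by apply: cvgD; [exact: cvg_cst | apply: cvgM; [exact: cvg_cst | exact: cvg_half_expr]].
apply: (cvg_norm_le (@phiP t x t0) (cvg_cst _) r) => k.
have h0 := half_expr_ge0 k; have /andP[a b] := polygon_time k t0.
have A := iter_euler_expansion L0 FL FM (Num.truncn (t * 2 ^+ k)) x h0.
rewrite -/(polygon F k t x) in A.
set s := 2^-1 ^+ k *+ _ in a b A.
rewrite (_ : _ - _ = (polygon F k t x - (x + s *: F x)) + (s - t) *: F x); last first.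
  by rewrite scalerBl !opprD !addrA subrK.
apply: (le_trans (ler_normD _ _)); rewrite normrZ; apply: lerD.
  apply: (le_trans A); rewrite ler_wpM2l ?mulr_ge0 // lerXn2r ?nnegrE //.
  by rewrite /s mulrn_wge0.
by rewrite mulrC; apply: ler_pM => //; rewrite ler0_norm; lra.
Qed.

Lemma semiflow_drift t x : 0 <= t -> `|phi t x - x| <= M * t.
Proof.
move=> t0; have r : M * t @[_ --> \oo] --> M * t by exact: cvg_cst.
apply: (cvg_norm_le (@phiP t x t0) (cvg_cst _) r) => k.
apply: (le_trans (iter_euler_drift FM _ _ (half_expr_ge0 k))).
by rewrite mulrC ler_wpM2l //; have /andP[] := polygon_time k t0.
Qed.

(** The Lipschitz bound of [polygon F k s] is uniform in [k], so the limit may be taken in the inner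
    polygon as well. *)
Lemma semiflowD s t x : 0 <= s -> 0 <= t -> phi (s + t) x = phi s (phi t x).
Proof.
move=> s0 t0; have st0 : 0 <= s + t by rewrite addr_ge0.
apply/eqP; rewrite -subr_eq0 -normr_le0.
have r : M * 2^-1 ^+ k + expR (L * s) * `|polygon F k t x - phi t x|
    @[k --> \oo] --> (M * 0 + expR (L * s) * `|phi t x - phi t x| : R).
  apply: cvgD; apply: cvgM; try exact: cvg_cst; first exact: cvg_half_expr.
  by apply: cvg_norm; apply: cvgB; [exact: phiP | exact: cvg_cst].
rewrite subrr normr0 !mulr0 addr0 in r.
apply: (cvg_norm_le (@phiP _ x st0) (phiP s0) r) => k.
rewrite -(subrK (polygon F k s (polygon F k t x)) (polygon F k (s + t) x)) -addrA.
apply: (le_trans (ler_normD _ _)); apply: lerD; last exact: polygon_lipschitz.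
have tk (u : R) : 0 <= u -> 0 <= u * 2 ^+ k by move=> u0; rewrite mulr_ge0 // exprn_ge0.
have /andP[a1 b1] := truncn_itv (tk s s0).
have /andP[a2 b2] := truncn_itv (tk t t0).
rewrite /polygon; set n := Num.truncn _ in a1 b1 *; set m := Num.truncn (t * _) in a2 b2 *.
(* Truncation is additive up to one step, whose contribution [M * 2^-k] vanishes in the limit. *)
have [b -> bn] : exists2 b, Num.truncn ((s + t) * 2 ^+ k) = (b + (n + m))%N & (b <= 1)%N.
  have a3 : (n + m <= Num.truncn ((s + t) * 2 ^+ k))%N.
    by rewrite truncn_ge_nat ?tk // natrD mulrDl lerD.
  have b3 : (Num.truncn ((s + t) * 2 ^+ k) < n.+1 + m.+1)%N.
    by rewrite truncn_lt_nat ?tk // natrD mulrDl ltrD.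
  exists (Num.truncn ((s + t) * 2 ^+ k) - (n + m))%N; first by rewrite subnK.
  by rewrite leq_subLR -ltnS addn1 -addnS -addSn.
rewrite iterD iterD; apply: (le_trans (iter_euler_drift FM _ _ (half_expr_ge0 k))).
rewrite mulrC ler_wpM2l // -[leRHS]mulr1n ler_wpMn2l //; exact: half_expr_ge0.
Qed.

Lemma semiflow_time_lipschitz s t x : 0 <= s -> 0 <= t ->
  `|phi s x - phi t x| <= M * `|s - t|.
Proof.
move=> s0 t0; wlog ts : s t s0 t0 / t <= s.
  move=> H; have [|/ltW] := leP t s; first exact: H.
  by move=> /(H _ _ t0 s0); rewrite distrC [X in M * X]distrC.
have st0 : 0 <= s - t by rewrite subr_ge0.
rewrite (ger0_norm st0) -[in phi s x](subrK t s) semiflowD //.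
exact: semiflow_drift.
Qed.

Lemma semiflow0 x : phi 0 x = x.
Proof.
apply/eqP; rewrite -subr_eq0 -normr_le0.
by have := semiflow_drift x (lexx 0); rewrite mulr0.
Qed.

(** Every vertex of every polygon lies in [C], and [C] is closed. This replaces differentiation
    along orbits in the sequel. *)
Lemma semiflow_invariant (C : set E) t x : closed C ->
  (forall h y, 0 <= h -> C y -> C (y + h *: F y)) ->
  0 <= t -> C x -> C (phi t x).
Proof.
move=> cC CF t0 Cx; apply: (closed_cvg C cC _ _ (@phiP t x t0)).
apply: nearW => k; rewrite /polygon; elim: (Num.truncn _) => //= n IH.
by apply: CF => //; exact: half_expr_ge0.
Qed.

End LipschitzBounded.

(** Forward and backward polygons of the same rank have the same number [n] of steps of length [h];
    undoing one step errs by [L * M * h ^+ 2], and [n * h ^+ 2 <= t * h] tends to 0. *)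
Lemma semiflow_reverse F (L M : R) phi psi t x : 0 <= L ->
  (forall x y, `|F x - F y| <= L * `|x - y|) -> (forall x, `|F x| <= M) ->
  semiflow F phi -> semiflow (fun z => - F z) psi ->
  0 <= t -> psi t (phi t x) = x.
Proof.
move=> L0 FL FM phiP psiP t0; have M0 := bound_ge0 FM.
have GL u v : `|- F u - - F v| <= L * `|u - v| by rewrite -opprD normrN.
have GM u : `|- F u| <= M by rewrite normrN.
apply/eqP; rewrite -subr_eq0 -normr_le0.
set C := expR (L * t).
have r : C * (L * M * t) * 2^-1 ^+ k + C * `|polygon F k t x - phi t x|
    @[k --> \oo] --> (C * (L * M * t) * 0 + C * `|phi t x - phi t x| : R).
  apply: cvgD; apply: cvgM; try exact: cvg_cst; first exact: cvg_half_expr.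
  by apply: cvg_norm; apply: cvgB; [exact: phiP | exact: cvg_cst].
rewrite subrr normr0 !mulr0 addr0 in r.
apply: (cvg_norm_le (psiP _ _ t0) (cvg_cst _) r) => k.
set G := fun z => - F z.
rewrite -(subrK (polygon G k t (polygon F k t x)) (polygon G k t (phi t x))) -addrA.
apply: (le_trans (ler_normD _ _)); rewrite [leRHS]addrC; apply: lerD.
  by rewrite [`|polygon F k t x - _|]distrC; exact: (polygon_lipschitz L0 GL).
have h0 := half_expr_ge0 k; have /andP[_ nt] := polygon_time k t0.
have K1 : 1 <= 1 + L * 2^-1 ^+ k by rewrite lerDl mulr_ge0.
rewrite /polygon; set h := 2^-1 ^+ k in h0 nt K1 *; set n := Num.truncn _ in nt *.
have e0 : 0 <= L * M * h ^+ 2 by rewrite !mulr_ge0 // sqr_ge0.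
apply: (le_trans (iter_inverse n x K1 e0 _ _)).
- by move=> u v; exact: euler_lipschitz.
- by move=> u; exact: euler_reverse.
rewrite -[leRHS]mulrA; apply: ler_pM.
- by rewrite exprn_ge0 // (le_trans _ K1).
- by rewrite mulrn_wge0.
- exact: one_plus_exp_le.
by rewrite -mulrnAr -[leRHS]mulrA ler_wpM2l ?mulr_ge0 // expr2 -mulrnAl ler_wpM2r.
Qed.

End Semiflow.

(** * Orbits measured by a clock *)

Lemma lipschitz_at_continuous (R : realType) (E G : normedModType R) (f : E -> G) (K : R) x :
  (forall y, `|f x - f y| <= K * `|x - y|) -> {for x, continuous f}.
Proof.
move=> fK; apply/cvgrPdist_le => e e0.
have K1 : 0 < `|K| + 1 by have := normr_ge0 K; lra.
near=> y; apply: (le_trans (fK y)).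
apply: (@le_trans _ _ ((`|K| + 1) * `|x - y|)).
  by rewrite ler_wpM2r // (le_trans (ler_norm K)) // lerDl.
rewrite mulrC -ler_pdivlMr //; near: y.
by apply: cvgr_dist_le; [exact: cvg_id | exact: divr_gt0].
Unshelve. all: by end_near. Qed.

Lemma lipschitz_continuous (R : realType) (E G : normedModType R) (f : E -> G) (K : R) :
  (forall x y, `|f x - f y| <= K * `|x - y|) -> continuous f.
Proof. by move=> fK x; apply: lipschitz_at_continuous (fK x). Qed.

Lemma closed_le_fun (R : realType) (T : topologicalType) (f g : T -> R) :
  continuous f -> continuous g -> closed [set x | f x <= g x].
Proof.
move=> cf cg; rewrite (_ : [set x | _] = (fun x => g x - f x) @^-1` [set r | 0 <= r]).
  apply: closed_comp; last exact: closed_ge.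
  by move=> x _; apply: continuousB; [exact: cg | exact: cf].
by apply/seteqP; split => x /=; rewrite subr_ge0.
Qed.

Section Hitting.
Context {R : realType} {E : normedModType R}.
Variables (F : E -> E) (L M : R) (phi : R -> E -> E) (p : E -> R).
Hypotheses (L0 : 0 <= L) (FL : forall x y, `|F x - F y| <= L * `|x - y|)
  (FM : forall x, `|F x| <= M) (phiP : semiflow F phi).
Hypotheses (p_lin : forall x y h, p (x + h *: y) = p x + h * p y)
  (p_norm : forall x, `|p x| <= `|x|) (Fp : forall x, `|F x| <= p (F x)).

Let pB x y : p (x - y) = p x - p y.
Proof. by rewrite -[- y]scaleN1r p_lin mulN1r. Qed.

Lemma clock_continuous : continuous (p : E -> R^o).
Proof.
by apply: (@lipschitz_continuous _ _ _ _ 1) => x y; rewrite -pB mul1r.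
Qed.

(** The cone of the points [v] with [|v - u| <= p v - p u] is closed and stable under Euler steps,
    because [|F| <= p F]. *)
Lemma orbit_length s t z : 0 <= s -> s <= t ->
  `|phi t z - phi s z| <= p (phi t z) - p (phi s z).
Proof.
move=> s0 st; have ts0 : 0 <= t - s by rewrite subr_ge0.
rewrite -(subrK s t) (semiflowD L0 FL FM phiP) //; move: (phi s z) => u.
apply: (semiflow_invariant phiP (C := [set v | `|v - u| <= p v - p u])) => //.
- apply: closed_le_fun.
    by move=> x; apply: cvg_norm; apply: cvgB; [exact: cvg_id | exact: cvg_cst].
  by move=> x; apply: cvgB; [exact: clock_continuous | exact: cvg_cst].
- move=> h y h0 /= yu; rewrite p_lin [y + _ - u]addrAC.
  rewrite [leRHS]addrAC; apply: (le_trans (ler_normD _ _)); rewrite normrZ ger0_norm //.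
  by apply: lerD => //; rewrite ler_wpM2l.
by rewrite /= !subrr normr0.
Qed.

(** Along the orbit of [x], distance is controlled by clock difference; since the clocks of
    [phi s x] and [phi t y] agree, the delay between times [s] and [t] costs no more than
    [|phi t x - phi t y|], hence the factor 2. *)
Lemma hitting_lipschitz s t x y : 0 <= s -> 0 <= t -> p (phi s x) = p (phi t y) ->
  `|phi s x - phi t y| <= 2 * expR (L * t) * `|x - y|.
Proof.
move=> s0 t0 e.
have H1 : `|phi s x - phi t x| <= `|p (phi s x) - p (phi t x)|.
  have [st|/ltW ts] := leP s t.
    rewrite distrC [leRHS]distrC; apply: (le_trans (orbit_length x s0 st)).
    exact: ler_norm.
  by apply: (le_trans (orbit_length x t0 ts)); exact: ler_norm.
have H2 := semiflow_lipschitz L0 FL phiP x y t0.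
have H3 : `|p (phi s x) - p (phi t x)| <= `|phi t x - phi t y|.
  by rewrite e -pB [leRHS]distrC.
rewrite -(subrK (phi t x) (phi s x)) -addrA.
by apply: (le_trans (ler_normD _ _)); lra.
Qed.

Hypothesis Fp_gt0 : forall x, 0 < p (F x).

Lemma clock_increase z : exists2 t, 0 <= t <= 1 & p z < p (phi t z).
Proof.
set d := p (F z); have d0 : 0 < d by exact: Fp_gt0.
have M0 : 0 <= M by exact: bound_ge0 FM.
have LM0 : 0 <= L * M by rewrite mulr_ge0.
have dLM : 0 < d + L * M by lra.
(* With this time the first-order gain minus the second-order error, [d * t - L * M * t ^+ 2],
   equals [d * t ^+ 2], which is positive. *)
set t := d / (d + L * M).
have t0 : 0 < t by exact: divr_gt0.
have t1 : t <= 1 by rewrite /t ler_pdivrMr //; lra.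
exists t; first by rewrite (ltW t0).
have X := semiflow_expansion L0 FL FM phiP z (ltW t0).
have Y := le_trans (p_norm _) X; rewrite pB p_lin -/d in Y.
have : d * t - L * M * t ^+ 2 = d * t ^+ 2.
  have e : d * t = d - L * M * t by rewrite /t; field; rewrite gt_eqF.
  by transitivity (t * (d - L * M * t)); [ring | rewrite -e; ring].
have : 0 < d * t ^+ 2 by rewrite mulr_gt0 // exprn_gt0.
move: Y; rewrite ler_norml; lra.
Qed.

Hypothesis cE : seq_complete E.

(** A bounded clock would make the orbit Cauchy. Its limit [q] would satisfy [phi 1 q = q], although
    the clock is nondecreasing along orbits and exceeds [p q] at some time before 1. *)
Lemma clock_unbounded z c : exists n : nat, c <= p (phi n%:R z).
Proof.
apply: contrapT => H.
have lt n : p (phi n%:R z) < c by rewrite ltNge; apply/negP => Hn; apply: H; exists n.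
have mono m n : (m <= n)%N ->
    `|phi n%:R z - phi m%:R z| <= p (phi n%:R z) - p (phi m%:R z).
  by move=> mn; apply: orbit_length => //; rewrite ler_nat.
pose A := [set p (phi n%:R z) | n in [set: nat]].
have supA : has_sup A.
  by split; [exists (p (phi 0%:R z)); exists 0%N | exists c => _ [n _ <-]; exact: ltW].
have [q qP] : exists q : E, phi n%:R z @[n --> \oo] --> q.
  apply: cE => e e0; have [_ [N _ <-] HN] := sup_adherent e0 supA.
  exists N => m /mono /le_trans; apply.
  have : p (phi m%:R z) <= sup A by apply: sup_upper_bound => //; exists m.
  lra.
have q1 : phi 1 q = q.
  have c1 : continuous (phi 1).
    apply: (@lipschitz_continuous _ _ _ _ (expR (L * 1))) => x y.
    exact: (semiflow_lipschitz L0 FL phiP).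
  have cq : phi 1 (phi n%:R z) @[n --> \oo] --> phi 1 q.
    exact: (cvg_comp _ _ qP (c1 q)).
  have cq' : phi 1 (phi n%:R z) @[n --> \oo] --> q.
    rewrite (_ : (fun n => _) = (fun n : nat => phi n.+1%:R z)).
      by rewrite (cvg_shiftS (fun n : nat => phi n%:R z)).
    by apply/funext => n; rewrite -(semiflowD L0 FL FM phiP) // nat1r.
  exact: cvg_unique cq cq'.
have [t /andP[t0 t1] tq] := clock_increase q.
have := le_trans (normr_ge0 _) (orbit_length q t0 t1); rewrite q1; lra.
Qed.

Lemma hitting_exists z c : p z <= c -> exists2 t, 0 <= t & p (phi t z) = c.
Proof.
move=> zc; have [n cn] := clock_unbounded z c.
(* The semiflow is constrained only at nonnegative times; the absolute value gives a function
   continuous on the whole line, to which the intermediate value theorem applies. *)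
pose f (t : R) : R := p (phi `|t| z).
have cf : continuous f.
  apply: (@lipschitz_continuous _ _ R^o f M) => x y.
  rewrite /f -pB; apply: (le_trans (p_norm _)).
  apply: (@le_trans _ _ (M * `| `|x| - `|y| |)); last first.
    by rewrite ler_wpM2l ?ler_dist_dist // (bound_ge0 FM).
  exact: (semiflow_time_lipschitz L0 FL FM phiP).
have z0 := semiflow0 FM phiP z.
have f0 : f 0 = p z by rewrite /f normr0 z0.
have fn : f n%:R = p (phi n%:R z) by rewrite /f ger0_norm.
have [|t _ ft] := @IVT R f 0 n%:R c (ler0n _ n) (continuous_subspaceT cf).
  by rewrite f0 fn minEle maxEle (le_trans zc cn) zc cn.
by exists `|t|.
Qed.

End Hitting.

Lemma completeNormedModType_seq_complete (R : realType) (V : completeNormedModType R) :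
  seq_complete V.
Proof.
move=> u uC.
suff : cvg (u @ \oo) by move=> uc; exists (limn u).
apply: cauchy_cvg; apply: cauchy_exP => e e0.
have e2 : 0 < e / 2 by lra.
have [N uN] := uC _ e2; exists (u N); exists N => // m /= Nm.
by rewrite -ball_normE /= distrC (le_lt_trans (uN m Nm)) //; lra.
Qed.

(** * Maps between levels of V x R *)

Section Slice.
Context {R : realType} {V : completeNormedModType R}.
Local Notation E := (V * R^o)%type.

Lemma prod_norm_le (z : E) (c : R) : (`|z| <= c) = (`|z.1| <= c) && (`|z.2| <= c).
Proof. by rewrite prod_normE ge_max. Qed.

Lemma prod_seq_complete : seq_complete E.
Proof.
move=> u uC.
have C1 : exists l : V, (u n).1 @[n --> \oo] --> l.
  apply: completeNormedModType_seq_complete => e /uC[N uN].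
  by exists N => m /uN; rewrite prod_norm_le => /andP[].
have C2 : exists l : R^o, (u n).2 @[n --> \oo] --> l.
  apply: (@completeNormedModType_seq_complete R R^o) => e /uC[N uN].
  by exists N => m /uN; rewrite prod_norm_le => /andP[].
have [l1 ul1] := C1; have [l2 ul2] := C2; exists (l1, l2).
apply: cvg_trans (cvg_pair ul1 ul2).
by apply: near_eq_cvg; near=> n; rewrite /=; case: (u n).
Unshelve. all: by end_near. Qed.

Section Map.
Variables (W : V -> V) (r : V -> R) (L M a b sg : R) (phi : R -> E -> E).
Hypotheses (L0 : 0 <= L)
  (WL : forall x y, `|W x - W y| <= L * `|x - y|)
  (rL : forall x y, `|r x - r y| <= L * `|x - y|)
  (sg1 : `|sg| = 1) (ab : sg * a <= sg * b)
  (Wr : forall x, `|W x| <= sg * r x) (r_gt0 : forall x, 0 < sg * r x)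
  (rM : forall x, sg * r x <= M).

Definition lift_field (z : E) : E := (W z.1, r z.1).

Lemma lift_field_lipschitz x y : `|lift_field x - lift_field y| <= L * `|x - y|.
Proof.
rewrite prod_norm_le /=; apply/andP; split.
  apply: (le_trans (WL _ _)); rewrite ler_wpM2l //.
  by have := lexx `|x - y|; rewrite {1}prod_norm_le => /andP[].
apply: (le_trans (rL _ _)); rewrite ler_wpM2l //.
by have := lexx `|x - y|; rewrite {1}prod_norm_le => /andP[].
Qed.

(** The product carries the maximum norm, so [|W| <= sg * r] bounds the whole lifted field by the
    speed of the clock [sg * z.2]. *)
Lemma lift_field_norm z : `|lift_field z| <= sg * (lift_field z).2.
Proof.
rewrite prod_norm_le /= Wr /=.
by rewrite -[leLHS]mul1r -sg1 -normrM gtr0_norm.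
Qed.

Lemma lift_field_bounded z : `|lift_field z| <= M.
Proof. exact: le_trans (lift_field_norm z) (rM _). Qed.

Let p_lin (x y : E) (h : R) : sg * (x + h *: y).2 = sg * x.2 + h * (sg * y.2).
Proof. by rewrite /= /GRing.scale /=; ring. Qed.

Let p_norm (x : E) : `|sg * x.2| <= `|x|.
Proof.
rewrite normrM sg1 mul1r.
by have := lexx `|x|; rewrite {1}prod_norm_le => /andP[].
Qed.

Hypothesis phiP : semiflow lift_field phi.

Lemma lift_orbit_length t z : 0 <= t ->
  `|(phi t z).1 - z.1| <= sg * (phi t z).2 - sg * z.2.
Proof.
move=> t0.
have z0 := semiflow0 lift_field_bounded phiP z.
have := orbit_length L0 lift_field_lipschitz lift_field_bounded phiP p_lin p_norm
  lift_field_norm z (lexx 0) t0.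
by rewrite z0 prod_norm_le => /andP[].
Qed.

Lemma lift_orbit_unique s t z : 0 <= s -> 0 <= t ->
  (phi s z).2 = (phi t z).2 -> phi s z = phi t z.
Proof.
move=> s0 t0 e; apply/eqP; rewrite -subr_eq0 -normr_le0.
have := hitting_lipschitz L0 lift_field_lipschitz lift_field_bounded phiP p_lin p_norm
  lift_field_norm (x := z) (y := z) s0 t0.
by rewrite e subrr normr0 mulr0; apply.
Qed.

(** The sign [sg] serves both directions: 1 for climbing from level [a] to level [b], -1 for
    descending along the reversed field. *)
Lemma slice_map : exists2 H : V -> V, continuous H &
  forall x, exists2 t, 0 <= t & phi t (x, a) = (H x, b).
Proof.
have K (x : V) : exists y, exists2 t, 0 <= t & phi t (x, a) = (y, b).
  have [t t0 tb] := hitting_exists L0 lift_field_lipschitz lift_field_bounded phiP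
    p_lin p_norm lift_field_norm (fun z => r_gt0 z.1) prod_seq_complete
    (z := (x, a)) (c := sg * b) ab.
  exists (phi t (x, a)).1, t => //; rewrite [LHS]surjective_pairing.
  have sg0 : sg != 0 by rewrite -normr_eq0 sg1 oner_eq0.
  by congr (_, _); exact: (mulfI sg0).
have [H HP] := choice K; exists H => // x.
have [t t0 tx] := HP x.
(* The constant depends on the hitting time [t] of the fixed point [x] but not on that of [y], so it
   gives continuity at [x]. *)
apply: (@lipschitz_at_continuous _ _ _ _ (2 * expR (L * t))) => y.
have [s s0 sy] := HP y.
have := hitting_lipschitz L0 lift_field_lipschitz lift_field_bounded phiP p_lin p_norm
  lift_field_norm (x := (y, a)) (y := (x, a)) s0 t0.
rewrite tx sy => /(_ erefl); rewrite prod_norm_le /= => /andP[+ _].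
rewrite [X in _ -> X <= _]distrC => /le_trans; apply; rewrite ler_wpM2l ?mulr_ge0 ?expR_ge0 //.
by rewrite prod_norm_le /= distrC subrr normr0 lexx normr_ge0.
Qed.

End Map.

Section Homeomorphism.
Variables (W : V -> V) (r : V -> R) (L M tau : R) (phi : R -> E -> E).
Hypotheses (L0 : 0 <= L)
  (WL : forall x y, `|W x - W y| <= L * `|x - y|)
  (rL : forall x y, `|r x - r y| <= L * `|x - y|)
  (Wr : forall x, `|W x| <= r x) (r_gt0 : forall x, 0 < r x)
  (rM : forall x, r x <= M) (tau0 : 0 <= tau).
Hypothesis phiP : semiflow (lift_field W r) phi.

Lemma slice_homeomorphism : exists H eta : V -> V,
  [/\ continuous H, continuous eta, cancel H eta, cancel eta H &
    forall x, exists2 t, 0 <= t & phi t (x, 0) = (H x, tau)].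
Proof.
pose W' x := - W x; pose r' x := - r x.
have fE : lift_field W' r' = (fun z => - lift_field W r z) by apply/funext.
have WL' x y : `|W' x - W' y| <= L * `|x - y| by rewrite /W' -opprD normrN; exact: WL.
have rL' x y : `|r' x - r' y| <= L * `|x - y| by rewrite /r' -opprD normrN; exact: rL.
have rE x : -1 * r' x = r x by rewrite mulN1r opprK.
have Wr' x : `|W' x| <= -1 * r' x by rewrite rE normrN.
have r0' x : 0 < -1 * r' x by rewrite rE.
have rM' x : -1 * r' x <= M by rewrite rE.
have Wr1 x : `|W x| <= 1 * r x by rewrite mul1r.
have r01 x : 0 < 1 * r x by rewrite mul1r.
have rM1 x : 1 * r x <= M by rewrite mul1r.
have FL := lift_field_lipschitz L0 WL rL.
have sg1 : `|1 : R| = 1 by rewrite normr1.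
have FM := lift_field_bounded sg1 Wr1 r01 rM1.
have GL := lift_field_lipschitz L0 WL' rL'.
have sgN : `|-1 : R| = 1 by rewrite normrN1.
have GM := lift_field_bounded sgN Wr' r0' rM'.
have [psi psiP] := semiflow_exists L0 GL GM prod_seq_complete.
have psiP' : semiflow (fun z => - lift_field W r z) psi by rewrite -fE.
have phiP' : semiflow (fun z => - lift_field W' r' z) phi.
  by rewrite (_ : (fun z => _) = lift_field W r) // fE; apply/funext => z; rewrite opprK.
have [H cH HP] := slice_map L0 WL rL sg1 (a := 0) (b := tau)
  (ler_wpM2l ler01 tau0) Wr1 r01 rM1 phiP.
have abN : -1 * tau <= -1 * 0 by rewrite mulr0 mulN1r oppr_le0.
have [eta ceta etaP] := slice_map L0 WL' rL' sgN abN Wr' r0' rM' psiP.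
exists H, eta; split=> // x.
(* The reversed orbit of [(H x, tau)] is at [(x, 0)] at time [t]; an orbit meets a level in a single
   point, so this is where [eta] stops. *)
- have [t t0 tx] := HP x; have [s s0 sx] := etaP (H x).
  have tx' : psi t (H x, tau) = (x, 0) by rewrite -tx (semiflow_reverse _ L0 FL FM phiP psiP').
  have : psi s (H x, tau) = psi t (H x, tau).
    by apply: (lift_orbit_unique L0 WL' rL' sgN Wr' r0' rM' psiP) => //; rewrite sx tx'.
  by rewrite sx tx' => -[].
- have [t t0 tx] := etaP x; have [s s0 sx] := HP (eta x).
  have tx' : phi t (eta x, 0) = (x, tau) by rewrite -tx (semiflow_reverse _ L0 GL GM psiP phiP').
  have : phi s (eta x, 0) = phi t (eta x, 0).
    by apply: (lift_orbit_unique L0 WL rL sg1 Wr1 r01 rM1 phiP) => //; rewrite sx tx'.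
  by rewrite sx tx' => -[].
Qed.

End Homeomorphism.
End Slice.

(** * Lipschitz fields subordinate to an open cover *)

(** For a well-ordering of the indices, [m p] is the least index whose set contains [p]. If each of
    [p] and [q] lies in the set chosen for the other, both choices are least among the indices of
    sets containing both points. *)
Lemma least_index (T : eqType) (I : T -> set T) : (forall a, I a a) ->
  exists m : T -> T, (forall p, I (m p) p) /\
    (forall p q, I (m p) q -> I (m q) p -> m p = m q).
Proof.
move=> II; have [le le_wo] := well_ordering_principle T.
have H p : exists a, minimum_of le [pred b | `[< I b p >]] a.
  have [|a [aP _]] := le_wo [pred b | `[< I b p >]]; last by exists a.
  by exists p; apply/asboolP.
have [m mP] := choice H; exists m.
have mI p : I (m p) p by have [/asboolP] := mP p.
split=> // p q pq qp.
have [|a [_ aU]] := le_wo [pred b | `[< I b p >] && `[< I b q >]].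
  by exists (m p); apply/andP; split; apply/asboolP.
rewrite -(aU (m p)); last first.
  split; first by apply/andP; split; apply/asboolP.
  by move=> x /andP[xp _]; have [_] := mP p; apply.
apply: aU; split; first by apply/andP; split; apply/asboolP.
by move=> x /andP[_ xq]; have [_] := mP q; apply.
Qed.

Section Layer.
Context {R : realType} {V : normedModType R}.
Variables (U : V -> set V) (m : V -> V) (e : R).
Hypotheses (e_gt0 : 0 < e) (mU : forall p q, U (m p) q -> U (m q) p -> m p = m q).

Let core := [set p | forall y, `|p - y| < 3 * e -> U (m p) y].

Let core_eq p q : core p -> core q -> `|p - q| < 3 * e -> m p = m q.
Proof. by move=> cp cq pq; apply: mU; [exact: cp | apply: cq; rewrite distrC]. Qed.

(* Cores with distinct indices are [3 * e] apart, so that their [e]-neighbourhoods,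
   on which [psi] is positive, are separated as well. *)
Lemma stone_layer : exists (psi : V -> R) (sel : V -> V),
  [/\ forall x, 0 <= psi x <= e,
      forall x y, `|psi x - psi y| <= `|x - y|,
      forall x, 0 < psi x -> U (sel x) x,
      forall x y, 0 < psi x -> 0 < psi y -> sel x <> sel y ->
        psi x + psi y <= `|x - y|
    & forall x, core x -> 0 < psi x].
Proof.
have e0 : 0 < e by exact: e_gt0.
(* The supremum of [A x] is the positive part of [e] minus the distance from [x] to the core; the
   element 0 keeps the set nonempty when the core is empty. *)
pose A x := [set c : R | c = 0 \/ exists2 p, core p & c = e - `|x - p|].
have supA x : has_sup (A x).
  split; first by exists 0; left.
  exists e => c [->|[p _ ->]]; first exact: ltW.
  by rewrite gerBl.
pose psi x := sup (A x).
have psi_ge x c : A x c -> c <= psi x by move=> Ac; apply: sup_upper_bound.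
have psi0 x : 0 <= psi x by apply: psi_ge; left.
have psie x : psi x <= e.
  apply: ge_sup; first by case: (supA x).
  by move=> c [->|[p _ ->]]; [exact: ltW | rewrite gerBl].
have psi_adh x d : 0 < d -> d <= psi x ->
    exists p, [/\ core p, `|x - p| < e & `|x - p| < e - psi x + d].
  move=> d0 dx; have [c [->|[p cp ->]] cx] := sup_adherent d0 (supA x).
    by move: cx; rewrite -/(psi x); lra.
  by exists p; split => //; move: cx; rewrite -/(psi x); lra.
have psi_lip x y : psi x - psi y <= `|x - y|.
  rewrite lerBlDr; apply: ge_sup; first by case: (supA x).
  move=> c [->|[p cp ->]]; first by rewrite addr_ge0.
  have := psi_ge y (e - `|y - p|) (or_intror (ex_intro2 _ _ p cp erefl)).
  have : `|y - p| <= `|x - y| + `|x - p| by rewrite [`|x - y|]distrC; exact: ler_distD.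
  lra.
have H x : exists a, 0 < psi x -> exists p, [/\ core p, `|x - p| < e & a = m p].
  have [x0|_] := ltP 0 (psi x); last by exists x.
  by have [p [cp xp _]] := psi_adh x _ x0 (lexx _); exists (m p) => _; exists p.
have [sel selP] := choice H.
have near_m x p q : `|x - p| < e -> `|x - q| < e -> core p -> core q -> m p = m q.
  move=> xp xq cp cq; apply: core_eq => //.
  have : `|p - q| <= `|x - p| + `|x - q| by rewrite [`|x - p|]distrC; exact: ler_distD.
  lra.
exists psi, sel; split.
- by move=> x; rewrite psi0 psie.
- by move=> x y; rewrite ler_norml psi_lip andbT lerNl opprB distrC psi_lip.
- move=> x /selP[p [cp xp ->]]; apply: cp; rewrite distrC.
  by apply: (lt_trans xp); lra.
- move=> x y x0 y0 xy.
  (* A slack of [e / 2] at each of the two points fits exactly: [3 * e <= |p - q|] then gives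
     [psi x + psi y <= |x - y|]. *)
  have key z : 0 < psi z ->
      exists p, [/\ core p, `|z - p| <= e - psi z + e / 2 & sel z = m p].
    move=> z0; pose d := Num.min (e / 2) (psi z).
    have d0 : 0 < d by rewrite lt_min z0 andbT divr_gt0.
    have [|p [cp zp zp']] := psi_adh z d d0; first by rewrite ge_min lexx orbT.
    have [q [cq zq ->]] := selP z z0.
    exists p; split => //; last exact: near_m zq zp cq cp.
    have : d <= e / 2 by rewrite ge_min lexx.
    lra.
  have [p [cp xp sx]] := key x x0; have [q [cq yq sy]] := key y y0.
  have [pq|pq] := ltP `|p - q| (3 * e).
    by case: xy; rewrite sx sy; exact: core_eq.
  have : `|p - q| <= `|x - p| + (`|x - y| + `|y - q|).
    rewrite [`|x - p|]distrC; apply: (le_trans (ler_distD x _ _)).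
    by rewrite lerD2l ler_distD.
  lra.
move=> x cx; apply: (lt_le_trans e_gt0); apply: psi_ge; right.
by exists x => //; rewrite subrr normr0 subr0.
Qed.

End Layer.

(** Where the selected indices agree, only the weight varies; where they differ, the two terms are
    bounded by [psi x + psi y], which the separation bounds by [|x - y|]. *)
Lemma layer_lipschitz (R : realType) (V E : normedModType R) (psi : V -> R)
    (sel : V -> V) (f : V -> E) x y :
  (forall x, 0 <= psi x) -> (forall x y, `|psi x - psi y| <= `|x - y|) ->
  (forall x y, 0 < psi x -> 0 < psi y -> sel x <> sel y -> psi x + psi y <= `|x - y|) ->
  (forall a, `|f a| <= 1) ->
  `|psi x *: f (sel x) - psi y *: f (sel y)| <= `|x - y|.
Proof.
move=> psi0 psiL psiS f1.
have Z z : `|psi z *: f (sel z)| <= psi z.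
  by rewrite normrZ ger0_norm // ler_piMr.
have := psi0 x; rewrite le_eqVlt => /orP[/eqP x0|x0].
  rewrite -x0 scale0r sub0r normrN; apply: (le_trans (Z y)).
  by have := psiL x y; rewrite -x0 sub0r normrN ger0_norm.
have := psi0 y; rewrite le_eqVlt => /orP[/eqP y0|y0].
  rewrite -y0 scale0r subr0; apply: (le_trans (Z x)).
  by have := psiL x y; rewrite -y0 subr0 ger0_norm.
have [e|/eqP ne] := eqVneq (sel x) (sel y).
  rewrite e -scalerBl normrZ; apply: le_trans (psiL x y).
  by rewrite ler_piMr.
apply: (le_trans (ler_normB _ _)); apply: le_trans (psiS x y x0 y0 ne).
exact: lerD.
Qed.

Section Field.
Context {R : realType} {V : completeNormedModType R}.
Local Notation E := (V * R^o)%type.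
Variables (U : V -> set V) (w : V -> V).
Hypotheses (U_open : forall a, open (U a)) (Ua : forall a, U a a)
  (w1 : forall a, `|w a| <= 1).

(** The layers, summed with weights [2^-n], have total Lipschitz constant at most 2. The last clause
    expresses that [(W x, r x)] is a limit of nonnegative combinations of the vectors [(w a, 1)]
    with [x] in [U a]. *)
Lemma lipschitz_field : exists (W : V -> V) (r : V -> R),
  [/\ forall x y, `|W x - W y| <= 2 * `|x - y|,
      forall x y, `|r x - r y| <= 2 * `|x - y|,
      forall x, 0 < r x <= 2
    & forall x (C : set E), closed C -> C 0 ->
        (forall t z a, 0 <= t -> C z -> U a x -> C (z + t *: ((w a, 1) : E))) ->
        C (W x, r x)].
Proof.
have [m [mI mU]] := least_index Ua.
have hp (n : nat) : 0 < 2^-1 ^+ n :> R by exact: half_expr_gt0.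
have [psi psiP] := choice (fun n => stone_layer (hp n) mU).
have {psiP}[sel psiP] := choice psiP.
pose f a : E := (w a, 1).
have f1 a : `|f a| <= 1 by rewrite prod_norm_le /= w1 normr1 lexx.
pose G n x : E := 2^-1 ^+ n *: (psi n x *: f (sel n x)).
pose S x n : E := \sum_(i < n) G i x.
have psi0 n x : 0 <= psi n x by have [/(_ x) /andP[]] := psiP n.
have psi1 n x : psi n x <= 1.
  have [/(_ x) /andP[_ +] _ _ _ _] := psiP n; move=> /le_trans; apply.
  by rewrite exprn_ile1 //; lra.
have G1 n x : `|G n x| <= 2^-1 ^+ n.
  rewrite normrZ ger0_norm; last exact: ltW.
  rewrite ler_piMr ?(ltW (hp n)) // normrZ ger0_norm //.
  by rewrite mulr_ile1.
have GL n x y : `|G n x - G n y| <= 2^-1 ^+ n * `|x - y|.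
  rewrite -scalerBr normrZ ger0_norm; last exact: ltW.
  rewrite ler_wpM2l ?(ltW (hp n)) //; have [_ psiL _ psiS _] := psiP n.
  exact: layer_lipschitz.
have sum2 n : \sum_(i < n) 2^-1 ^+ i <= 2 :> R.
  suff -> : \sum_(i < n) 2^-1 ^+ i = 2 - 2 * 2^-1 ^+ n :> R.
    by have := hp n; lra.
  elim: n => [|n IH]; first by rewrite big_ord0 expr0; lra.
  by rewrite big_ord_recr /= IH exprS; field.
have Slim x : exists l : E, S x n @[n --> \oo] --> l.
  apply: (@cvg_geometric_steps _ _ _ 1); first exact: prod_seq_complete.
  by move=> k; rewrite /S big_ord_recr /= [X in X - _]addrC addrK mul1r.
have [F FP] := choice Slim.
have F2 x : `|F x| <= 2.
  have c0 : (0 : E) @[_ --> \oo] --> (0 : E) by exact: cvg_cst.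
  have c2 : (2 : R) @[_ --> \oo] --> (2 : R) by exact: cvg_cst.
  rewrite -[F x]subr0; apply: (cvg_norm_le (FP x) c0 c2) => n.
  rewrite subr0; apply: le_trans (sum2 n).
  by apply: (le_trans (ler_norm_sum _ _ _)); apply: ler_sum.
have FL x y : `|F x - F y| <= 2 * `|x - y|.
  have c2 : 2 * `|x - y| @[_ --> \oo] --> 2 * `|x - y| by exact: cvg_cst.
  apply: (cvg_norm_le (FP x) (FP y) c2) => n.
  rewrite /S -sumrB; apply: (@le_trans _ _ (\sum_(i < n) 2^-1 ^+ i * `|x - y|)).
    by apply: (le_trans (ler_norm_sum _ _ _)); apply: ler_sum.
  by rewrite -mulr_suml ler_wpM2r.
have snd_mono x i j : (i <= j)%N -> (S x i).2 <= (S x j).2.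
  move=> ij; rewrite -(subnK ij); elim: (j - i)%N => // k.
  move=> /le_trans; apply; rewrite addSn /S big_ord_recr /= lerDl.
  by rewrite /GRing.scale /= !mulr_ge0 // ltW.
(* A ball about [x] of radius [3 * 2^-n] lies in the open set [U (m x)] for some [n], so layer [n]
   is positive at [x]; the second coordinates of the partial sums never decrease. *)
have F0 x : 0 < (F x).2.
  have [n cn] : exists n, forall y, `|x - y| < 3 * 2^-1 ^+ n -> U (m x) y.
    have /nbhs_ballP[d /= d0 dU] : nbhs x (U (m x)) by apply: open_nbhs_nbhs.
    have [n nd] := small_half_expr 3 d0; exists n => y xy.
    by apply: dU; rewrite -ball_normE /=; apply: lt_le_trans xy nd.
  have Sn : 0 < (S x n.+1).2.
    rewrite /S big_ord_recr /= ltr_wpDl //.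
      by have := snd_mono x 0%N n isT; rewrite /S big_ord0.
    rewrite /GRing.scale /= !mulr_gt0 //.
    by have [_ _ _ _ +] := psiP n; apply.
  apply: (lt_le_trans Sn).
  apply: (closed_cvg (fun z : E => (S x n.+1).2 <= z.2) _ _ _ (FP x)).
    apply: closed_le_fun; first by move=> ?; exact: cvg_cst.
    by move=> z; apply: cvg_snd.
  by exists n.+1 => // k /= nk; exact: snd_mono.
have FE x : ((F x).1, (F x).2) = F x by rewrite -surjective_pairing.
exists (fun x => (F x).1), (fun x => (F x).2); split.
- by move=> x y; have := FL x y; rewrite prod_norm_le => /andP[].
- by move=> x y; have := FL x y; rewrite prod_norm_le => /andP[].
- move=> x; rewrite F0 /=; have := F2 x; rewrite prod_norm_le => /andP[_].
  exact/le_trans/ler_norm.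
move=> x C cC C0 CU; rewrite FE; apply: (closed_cvg C cC _ _ (FP x)).
apply: nearW => n; rewrite /S; elim: n => [|n IH]; first by rewrite big_ord0.
rewrite big_ord_recr /= /G scalerA.
have := psi0 n x; rewrite le_eqVlt => /orP[/eqP<-|x0].
  by rewrite mulr0 scale0r addr0.
apply: CU => //; first by rewrite mulr_ge0 // ltW.
by have [_ _ + _ _] := psiP n; apply.
Qed.

End Field.

(** * Pseudo-gradient fields and deformations *)

Section DualNorm.
Context {R : realType} {V : normedModType R}.

Lemma diff_bound (Phi : V -> R) x : differentiable Phi x ->
  exists2 C, 0 < C & forall v, `|'d Phi x v| <= C * `|v|.
Proof.
move=> dPhi; have cd : {for 0, continuous 'd Phi x} by exact: diff_continuous.
have /linear_boundedP := continuous_linear_bounded 0 cd.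
move=> [C [_ CP]]; exists (`|C| + 1); first by have := normr_ge0 C; lra.
by apply: CP; rewrite ltr_pwDr // ler_norm.
Qed.

(** The bound [C] ensures that the [sup] defining [dual_norm] is taken over a bounded set. *)
Lemma dual_norm_ge (l : V -> R) (C : R) v :
  (forall v, `|l v| <= C * `|v|) -> `|v| <= 1 -> `|l v| <= dual_norm l.
Proof.
move=> lC v1; apply: sup_upper_bound; last by exists v.
split; first by exists `|l 0|, 0 => //=; rewrite normr0.
exists `|C| => _ [u /= u1 <-]; apply: (le_trans (lC u)).
apply: (@le_trans _ _ (`|C| * `|u|)); first by rewrite ler_wpM2r // ler_norm.
by rewrite ler_piMr.
Qed.

Lemma diff_expansion (Phi : V -> R) x (e : R) : differentiable Phi x -> 0 < e ->
  exists2 d, 0 < d & forall v, `|v| < d ->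
    `|Phi (x + v) - Phi x - 'd Phi x v| <= e * `|v|.
Proof.
move=> dPhi e0; have /eqaddoP/(_ e e0)/nbhs_ballP[d d0 dP] := diff_locally dPhi.
exists d => // v vd; have := dP v; rewrite -ball_normE /= sub0r normrN => /(_ vd).
by rewrite [x + v]addrC !fctE /= opprD addrA.
Qed.

End DualNorm.

Section ContinuouslyDifferentiable.
Context {R : realType} {V : normedModType R}.
Variable Phi : V -> R.
Hypothesis Phi_C1 : C1 Phi.

Let dPhi x : differentiable Phi x. Proof. by case: Phi_C1. Qed.

Lemma C1_continuous : continuous Phi.
Proof. by move=> x; exact: differentiable_continuous. Qed.

Lemma diff_sub_bound x y : exists C, forall v, `|'d Phi x v - 'd Phi y v| <= C * `|v|.
Proof.
have [C _ CP] := diff_bound (dPhi x); have [D _ DP] := diff_bound (dPhi y).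
exists (C + D) => v; apply: (le_trans (ler_normB _ _)).
by rewrite mulrDl lerD.
Qed.

Lemma diff_dist_le x y v : `|v| <= 1 ->
  `|'d Phi x v - 'd Phi y v| <= dual_norm (fun h => 'd Phi x h - 'd Phi y h).
Proof. by have [C CP] := diff_sub_bound x y; exact: (dual_norm_ge CP). Qed.

Lemma open_slope (k : R) v : `|v| <= 1 -> open [set x | k < 'd Phi x v].
Proof.
move=> v1; rewrite openE => x /= kx; rewrite /interior.
have := (proj2 Phi_C1) x.
have e0 : 0 < 'd Phi x v - k by rewrite subr_gt0.
move=> /cvgrPdist_lt /(_ _ e0); apply: filterS => y /=.
rewrite sub0r normrN => /(le_lt_trans (ler_norm _)) H.
have := le_lt_trans (diff_dist_le y x v1) H; rewrite ltr_norml => /andP[+ _].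
by rewrite opprB ltrBrDr subrK.
Qed.

End ContinuouslyDifferentiable.

Section PseudoGradient.
Context {R : realType} {V : completeNormedModType R}.
Local Notation E := (V * R^o)%type.
Variable Phi : V -> R.
Hypothesis Phi_C1 : C1 Phi.

Lemma pseudo_gradient (T B : set V) (k : R) : closed T -> closed B ->
  T `&` B = set0 ->
  (forall x, T x -> exists2 v, `|v| <= 1 & k < 'd Phi x v) ->
  exists (W : V -> V) (r : V -> R),
    [/\ forall x y, `|W x - W y| <= 2 * `|x - y|,
        forall x y, `|r x - r y| <= 2 * `|x - y|,
        forall x, [/\ 0 < r x, r x <= 2 & `|W x| <= r x],
        forall x, B x -> W x = 0
      & forall x, T x -> k * r x <= 'd Phi x (W x)].
Proof.
move=> cT cB TB slope.
(* Near a point of [T], one steep direction serves on a neighbourhood that avoids [B]; off [T], the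
   zero vector serves on the complement of [T]. *)
have H a : exists vU : V * set V, [/\ open vU.2, vU.2 a, `|vU.1| <= 1 &
    forall x, vU.2 x -> (T x -> k <= 'd Phi x vU.1) /\ (B x -> vU.1 = 0)].
  have [Ta|nTa] := pselect (T a).
    have [v v1 kv] := slope a Ta.
    exists (v, [set x | k < 'd Phi x v] `&` ~` B); split => //=.
    - by apply: openI; [exact: (open_slope Phi_C1) | exact: closed_openC].
    - by split=> // Ba; have : (T `&` B) a by []; rewrite TB.
    - by move=> x [kx nB]; split=> [_|/nB //]; exact: ltW.
  exists (0, ~` T); split => /=.
  - exact: closed_openC.
  - by [].
  - by rewrite normr0.
  - by move=> x nT; split.
have [wU wUP] := choice H.
have [|||W [r [WL rL r2 WC]]] := @lipschitz_field R V (fun a => (wU a).2) (fun a => (wU a).1).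
- by move=> a; have [] := wUP a.
- by move=> a; have [] := wUP a.
- by move=> a; have [] := wUP a.
have cfst : continuous (fst : E -> V) by move=> z; exact: cvg_fst.
have csnd : continuous (snd : E -> R^o) by move=> z; exact: cvg_snd.
have cnorm : continuous (fun z : E => `|z.1|).
  by move=> z; apply: cvg_norm; exact: cfst.
exists W, r; split => //.
- move=> x; have /andP[r0 r2x] := r2 x; split=> //.
  (* Each remaining property of [(W x, r x)] defines a closed cone to which the closure clause of
     [lipschitz_field] applies. *)
  apply: (WC x [set z | `|z.1| <= z.2]).
  + exact: closed_le_fun.
  + by rewrite /= normr0.
  + move=> t z a t0 /= zz _; apply: (le_trans (ler_normD _ _)); apply: lerD => //.
    rewrite normrZ ger0_norm // /GRing.scale /= ler_wpM2l //.
    by have [] := wUP a.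
- move=> x Bx; apply/eqP; rewrite -normr_le0.
  apply: (WC x [set z | `|z.1| <= 0]).
  + by apply: closed_le_fun => // ?; exact: cvg_cst.
  + by rewrite /= normr0.
  + move=> t z a t0 /= zz Ux; have [_ _ _ /(_ x Ux)[_ /(_ Bx) ->]] := wUP a.
    by rewrite scaler0 addr0.
move=> x Tx; apply: (WC x [set z | k * z.2 <= 'd Phi x z.1]).
- apply: closed_le_fun.
    by move=> z; apply: cvgM; [exact: cvg_cst | exact: csnd].
  have cd : continuous ('d Phi x) by apply: diff_continuous; case: Phi_C1.
  by move=> z; apply: (cvg_comp fst 'd Phi x (cfst z)); exact: cd.
- by rewrite /= linear0 mulr0.
move=> t z a t0 /= zz Ux; have [_ _ _ /(_ x Ux)[/(_ Tx) ka _]] := wUP a.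
rewrite linearD linearZ /= mulrDr; apply: lerD => //.
by rewrite /GRing.scale /= mulr1 mulrC ler_wpM2l.
Qed.

End PseudoGradient.

(** The last time [s] in [[0, b]] with [0 <= g s] is [b]: before [b] it could be exceeded, by
    continuity if [g s] is positive and by the hypothesis if [g s = 0]. *)
Lemma barrier (R : realType) (g : R -> R) (b : R) : continuous g -> 0 <= b ->
  0 <= g 0 ->
  (forall t, 0 <= t < b -> g t = 0 ->
    exists2 d, 0 < d & forall h, 0 < h < d -> 0 <= g (t + h)) ->
  0 <= g b.
Proof.
move=> cg b0 g0 gP; pose A := [set t | 0 <= t <= b /\ 0 <= g t].
have A0 : A 0 by split=> //; rewrite lexx.
have supA : has_sup A by split; [exists 0 | exists b => t [/andP[]]].
pose s := sup A.
have s0 : 0 <= s by exact: sup_upper_bound.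
have sb : s <= b by apply: ge_sup; [exists 0 | move=> t [/andP[]]].
have ball_s e : 0 < e -> exists2 d, 0 < d & forall t, `|s - t| < d -> `|g s - g t| < e.
  move=> e0; have /cvgrPdist_lt/(_ e e0)/nbhs_ballP[d d0 dP] := cg s.
  by exists d => // t st; apply: dP.
have gs : 0 <= g s.
  rewrite leNgt; apply/negP => gs.
  have [|d d0 dP] := ball_s (- g s); first by rewrite oppr_gt0.
  have [t [tb gt] st] := sup_adherent d0 supA.
  rewrite -/s in st; have ts : t <= s by exact: sup_upper_bound.
  have /dP : `|s - t| < d by rewrite ger0_norm ?subr_ge0 //; lra.
  rewrite ltr_norml => /andP[+ _]; lra.
move: sb; rewrite le_eqVlt => /orP[/eqP <- //|sb]; exfalso.
have [d d0 dP] : exists2 d, 0 < d & forall h, 0 < h < d -> 0 <= g (s + h).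
  move: gs; rewrite le_eqVlt => /orP[/eqP gs|gs]; first by apply: gP => //; rewrite s0.
  have [d d0 dP] := ball_s _ gs; exists d => // h /andP[h0 hd].
  have : `|s - (s + h)| < d by rewrite opprD addNKr normrN gtr0_norm.
  by move=> /dP; rewrite ltr_norml => /andP[_]; lra.
pose h := Num.min (d / 2) (b - s).
have h0 : 0 < h by rewrite lt_min subr_gt0 sb andbT divr_gt0.
have hd : h <= d / 2 by rewrite ge_min lexx.
have hb : h <= b - s by rewrite ge_min lexx orbT.
have : A (s + h).
  split; first by apply/andP; split; lra.
  by apply: dP; rewrite h0 /=; lra.
move=> /(sup_upper_bound supA); rewrite -/s; lra.
Qed.

Section Climb.
Context {R : realType} {V : completeNormedModType R}.
Local Notation E := (V * R^o)%type.
Variables (Phi : V -> R) (W : V -> V) (r : V -> R) (phi : R -> E -> E).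
Hypotheses (Phi_C1 : C1 Phi)
  (WL : forall x y, `|W x - W y| <= 2 * `|x - y|)
  (rL : forall x y, `|r x - r y| <= 2 * `|x - y|)
  (rW : forall x, [/\ 0 < r x, r x <= 2 & `|W x| <= r x])
  (phiP : semiflow (lift_field W r) phi).

Let FL := lift_field_lipschitz (ler0n R 2) WL rL.

Let FM z : `|lift_field W r z| <= 2.
Proof.
have [r0 r2 Wr] := rW z.1.
by rewrite prod_norm_le /= (le_trans Wr r2) ger0_norm // ltW.
Qed.

Lemma climb_step (k k' : R) x a : k' < k -> k * r x <= 'd Phi x (W x) ->
  exists2 d, 0 < d & forall h, 0 < h < d ->
    Phi x - k' * a <= Phi (phi h (x, a)).1 - k' * (phi h (x, a)).2.
Proof.
move=> kk slope; have [rz0 rz2 Wrz] := rW x.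
have dPhi : differentiable Phi x by case: Phi_C1.
(* The surplus [h * m] pays for two errors of [h * m / 2]: the differentiability remainder, at most
   [m / 4 * (2 * h)], and the flow expansion, at most [D * h ^+ 2]. *)
pose m := (k - k') * r x; have m0 : 0 < m by rewrite mulr_gt0 ?subr_gt0.
have m4 : 0 < m / 4 by lra.
have [d d0 dP] := diff_expansion dPhi m4.
have [C C0 CP] := diff_bound dPhi.
pose D := 4 * (C + `|k'|); have D0 : 0 < D.
  by rewrite mulr_gt0 // ltr_wpDr.
have D2 : 0 < 2 * D by lra.
exists (Num.min (d / 2) (m / (2 * D))).
  by rewrite lt_min; apply/andP; split; apply: divr_gt0.
move=> h /andP[h0]; rewrite lt_min => /andP[hd hm].
have E1 := semiflow_expansion (ler0n R 2) FL FM phiP (x, a) (ltW h0).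
have E2 := semiflow_drift FM phiP (x, a) (ltW h0).
move: E1 E2; rewrite !prod_norm_le /= => /andP[e1 e2] /andP[e3 _].
set X := (phi h (x, a)).1 in e1 e3 *; set A := (phi h (x, a)).2 in e2 *.
have e3' : `|X - x| < d by apply: (le_lt_trans e3); lra.
have := dP _ e3'; rewrite [x + (X - x)]addrC subrK => e4.
have e5 : `|'d Phi x (X - x) - h * 'd Phi x (W x)| <= C * (2 * 2 * h ^+ 2).
  have -> : 'd Phi x (X - x) - h * 'd Phi x (W x)
      = 'd Phi x (X - (x + h *: W x)).
    by rewrite opprD addrA [RHS]linearB [in RHS]linearZ.
  by apply: (le_trans (CP _)); rewrite ler_wpM2l // ltW.
have e6 : m / 4 * `|X - x| <= m / 4 * (2 * h) by rewrite ler_wpM2l // ltW.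
have e7 : `|k' * (A - (a + h * r x))| <= `|k'| * (2 * 2 * h ^+ 2).
  by rewrite normrM ler_wpM2l.
have e8 : h * (k * r x) <= h * 'd Phi x (W x) by rewrite ler_wpM2l // ltW.
have e9 : D * h ^+ 2 <= h * (m / 2).
  rewrite expr2 mulrCA ler_wpM2l ?(ltW h0) //.
  move: hm; rewrite ltr_pdivlMr // => /ltW; rewrite mulrCA mulrC; lra.
have e10 : D * h ^+ 2 = C * (2 * 2 * h ^+ 2) + `|k'| * (2 * 2 * h ^+ 2).
  by rewrite /D; ring.
move: (le_trans e4 e6) e5 e7; rewrite !ler_norml => /andP[b1 _] /andP[b2 _] /andP[_ b3].
have e11 : h * m = h * (k * r x) - k' * (h * r x) by rewrite /m; ring.
have e12 : k' * (A - (a + h * r x)) = k' * A - k' * a - k' * (h * r x).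
  by ring.
rewrite e12 in b3.
by lra.
Qed.

Let Wr1 x : `|W x| <= 1 * r x. Proof. by have [] := rW x; rewrite mul1r. Qed.
Let r01 x : 0 < 1 * r x. Proof. by have [] := rW x; rewrite mul1r. Qed.
Let rM1 x : 1 * r x <= 2. Proof. by have [] := rW x; rewrite mul1r. Qed.

(** The barrier argument is applied to [Phi] minus [k'] times the clock minus [b]. The slope is used
    only where this vanishes, so only such points, at distance at most the clock from [u], have to
    lie in [T]. *)
Lemma climb (T : set V) (b k k' tau t : R) (u v : V) : k' < k -> b <= Phi u ->
  (forall w, T w -> k * r w <= 'd Phi w (W w)) ->
  (forall w a, 0 <= a <= tau -> `|w - u| <= a -> Phi w = b + k' * a -> T w) ->
  0 <= t -> phi t (u, 0) = (v, tau) -> b + k' * tau <= Phi v.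
Proof.
move=> kk bu slope TP t0 tE.
have cPhi := C1_continuous Phi_C1.
pose c (s : R) : E := phi `|s| (u, 0).
have cc : continuous c.
  apply: (@lipschitz_continuous _ R^o _ c 2) => s s'.
  apply: (le_trans (semiflow_time_lipschitz (ler0n R 2) FL FM phiP _ _ _)) => //.
  by rewrite ler_wpM2l // ler_dist_dist.
pose g (s : R) : R := Phi (c s).1 - k' * (c s).2 - b.
have cg : continuous g.
  move=> s; apply: cvgB; last exact: cvg_cst.
  apply: cvgB.
    by apply: (cvg_comp (fun s => (c s).1) Phi); [apply: (cvg_comp c fst); [exact: cc | exact: cvg_fst] | exact: cPhi].
  apply: cvgM; first exact: cvg_cst.
  by apply: (cvg_comp c snd); [exact: cc | exact: cvg_snd].
have len s z : 0 <= s -> `|(phi s z).1 - z.1| <= (phi s z).2 - z.2.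
  move=> s0; have := lift_orbit_length (ler0n R 2) WL rL (normr1 R) Wr1 r01 rM1 phiP z s0.
  by rewrite !mul1r.
suff : 0 <= g t.
  rewrite /g /c ger0_norm // tE /=; lra.
apply: barrier => //.
  by rewrite /g /c normr0 (semiflow0 FM phiP) /= mulr0 subr0 subr_ge0.
move=> s /andP[s0 st] gs.
case E1 : (phi s (u, 0)) => [X A].
have XA : Phi X = b + k' * A.
  by move: gs; rewrite /g /c ger0_norm // E1 /=; lra.
have TX : T X.
  apply: (TP X A) => //.
    apply/andP; split.
      have := le_trans (normr_ge0 _) (len s (u, 0) s0); rewrite E1 /= subr0; exact.
    have ts : 0 <= t - s by rewrite subr_ge0 ltW.
    have := le_trans (normr_ge0 _) (len _ (phi s (u, 0)) ts).
    by rewrite -(semiflowD (ler0n R 2) FL FM phiP) // subrK tE E1 /= subr_ge0.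
  by have := len s (u, 0) s0; rewrite E1 /= subr0.
have [d d0 dP] := climb_step A kk (slope X TX).
exists d => // h /andP[h0 hd].
have := dP h; rewrite h0 hd => /(_ isT).
have sh0 : 0 <= s + h by rewrite addr_ge0 // ltW.
rewrite /g /c (ger0_norm sh0) [s + h]addrC.
rewrite (semiflowD (ler0n R 2) FL FM phiP) ?(ltW h0) // E1; lra.
Qed.

End Climb.

(** * The deformation lifting S and fixing B *)

Section Deformation.
Context {R : realType} {V : completeNormedModType R}.
Variables (Phi : V -> R) (S B : set V) (b k r0 : R).
Hypotheses (Phi_C1 : C1 Phi) (cS : closed S) (cB : closed B) (SB : S `&` B = set0)
  (PhiS : forall u, S u -> b <= Phi u) (PhiB : forall u, B u -> Phi u <= b)
  (k_gt0 : 0 < k) (r0_gt0 : 0 < r0)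
  (slope : forall u, b <= Phi u <= b + r0 -> (exists2 s, S s & `|u - s| <= 2 * r0) ->
    exists2 v, `|v| <= 1 & k < 'd Phi u v).

(* [T] contains every point that the deformation moves [S] through while [Phi]
   is still close to [b]; on [T] the value of [Phi] exceeds [b] in proportion to
   the distance to [S], which keeps [T] away from [B] even if [S] and [B] are
   at distance zero. *)
Let T0 := [set u | exists2 s, S s &
  `|u - s| <= r0 /\ b + k / 2 * `|u - s| <= Phi u <= b + r0].
Let T := closure T0.

Let T_near (u : V) (e : R) : T u -> 0 < e -> exists v s,
  [/\ S s, `|u - v| < e, `|Phi u - Phi v| < e, `|v - s| <= r0
    & b + k / 2 * `|v - s| <= Phi v <= b + r0].
Proof.
move=> Tu e0.
have N1 : nbhs u [set v | `|Phi u - Phi v| < e].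
  by have /cvgrPdist_lt/(_ e e0) := @C1_continuous _ _ _ Phi_C1 u.
have N2 : nbhs u [set v | `|u - v| < e].
  by apply/nbhs_ballP; exists e => //= v; rewrite -ball_normE.
have [v [[s Ss [vs vb]] [v1 v2]]] := Tu _ (filterI N1 N2).
by exists v, s.
Qed.

Let T_B : T `&` B = set0.
Proof.
have k0 := k_gt0.
rewrite -subset0 => u [Tu Bu].
suff Su : S u by have : (S `&` B) u by []; rewrite SB.
apply: cS => N /nbhs_ballP[d /= d0 dN].
(* Since [Phi u <= b], a point [v] within [e] has [k / 2 * |v - s| < e], so [v] is within [d / 2] of
   [s]; the other half of [d] covers [|u - v|]. Thus [u] lies in the closure of [S]. *)
pose e := Num.min (d / 2) (k / 4 * d).
have e0 : 0 < e by rewrite lt_min divr_gt0 ?mulr_gt0 ?divr_gt0.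
have e1 : e <= d / 2 by rewrite ge_min lexx.
have e2 : e <= k / 4 * d by rewrite ge_min lexx orbT.
have [v [s [Ss uv]]] := T_near Tu e0.
rewrite ltr_norml => /andP[Phiuv _] _ /andP[vb _].
exists s; split => //; apply: dN; rewrite -ball_normE /=.
have := PhiB Bu => ub.
have : k * `|v - s| < k * (d / 2) by lra.
rewrite ltr_pM2l // => vs.
have := ler_distD v u s => us; apply: (le_lt_trans us).
by lra.
Qed.

Let T_slope u : T u -> exists2 v, `|v| <= 1 & k < 'd Phi u v.
Proof.
have k0 := k_gt0; have rr := r0_gt0.
move=> Tu; apply: slope; last first.
  have [v [s [Ss uv _ vs _]]] := T_near Tu r0_gt0.
  exists s => //; apply: (le_trans (ler_distD v u s)); lra.
suff : T `<=` [set u | b <= Phi u <= b + r0] by apply.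
have cPhi := C1_continuous Phi_C1.
rewrite [X in _ `<=` X](_ : _ =
    [set u | b <= Phi u] `&` [set u | Phi u <= b + r0]); last first.
  by apply/seteqP; split => w /=; [move=> /andP[] | move=> [-> ->]].
have cI : closed ([set u | b <= Phi u] `&` [set u | Phi u <= b + r0]).
  by apply: closedI; apply: closed_le_fun => // ?; exact: cvg_cst.
rewrite [X in _ `<=` X](closure_id _).1 //; apply: closure_subset.
move=> w [s _ [_ /andP[sw wb]]]; split => //=; apply: le_trans sw.
by rewrite lerDl mulr_ge0 // divr_ge0 // ltW.
Qed.

(** [eta] is the inverse of the climbing map [H]: if [eta u] lies in [S], then [u = H (eta u)] is
    the end of an orbit issued from [S]. *)
Lemma deformation : exists eta : V -> V,
  [/\ homeomorphism eta, fixes B eta &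
    forall u, S (eta u) -> b + Num.min (k / 2 * r0) r0 <= Phi u].
Proof.
have k0 := k_gt0; have rr := r0_gt0.
have [W [r [WL rL rW WB WT]]] := pseudo_gradient Phi_C1 (@closed_closure _ T0) cB T_B T_slope.
have W_le x : `|W x| <= r x by have [] := rW x.
have r_gt0 x : 0 < r x by have [] := rW x.
have r_le x : r x <= 2 by have [] := rW x.
have FL := lift_field_lipschitz (ler0n R 2) WL rL.
have FM (z : V * R^o) : `|lift_field W r z| <= 2.
  rewrite prod_norm_le /= (le_trans (W_le z.1) (r_le z.1)) /=.
  by rewrite ger0_norm ?r_le // ltW.
have [phi phiP] := semiflow_exists (ler0n R 2) FL FM (@prod_seq_complete R V).
pose k' := k / 2; have k'0 : 0 < k' by rewrite divr_gt0.
(* Orbits then have length at most [r0] and the level [b + k' * a] stays below [b + r0], as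
   membership in [T0] requires; [k'] is half of [k] to leave [climb] a margin. *)
pose tau := Num.min r0 (r0 / k').
have tau0 : 0 <= tau by rewrite le_min divr_ge0 // ltW.
have ktau : k' * tau = Num.min (k' * r0) r0.
  by rewrite /tau minr_pMr ?(ltW k'0) // mulrCA divff ?mulr1 // gt_eqF.
have [H [eta [cH ceta HK etaK HP]]] :=
  slice_homeomorphism (ler0n R 2) WL rL W_le r_gt0 r_le tau0 phiP.
exists eta; split.
- by split=> //; exists H.
- move=> x Bx; rewrite -[in LHS](_ : H x = x) ?HK //.
  have [t t0 tE] := HP x.
  (* As [W x = 0], the lifted orbit of a point of [B] moves only in its clock coordinate. *)
  have : [set z : V * R^o | `|z.1 - x| <= 0] (phi t (x, 0)).
    apply: (semiflow_invariant phiP) => //.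
    + apply: closed_le_fun => [z|z]; last exact: cvg_cst.
      by apply: cvg_norm; apply: cvgB; [exact: cvg_fst | exact: cvg_cst].
    + move=> h y h0 /=; rewrite normr_le0 subr_eq0 => /eqP ->.
      by rewrite WB // scaler0 addr0 subrr normr0.
    + by rewrite /= subrr normr0.
  by rewrite tE /= normr_le0 subr_eq0 => /eqP.
move=> u Su; rewrite -/k' -ktau.
have [t t0 tE] := HP (eta u); rewrite etaK in tE.
have kk : k' < k by rewrite /k'; lra.
apply: (climb Phi_C1 WL rL rW phiP kk (PhiS Su) WT _ t0 tE) => w a /andP[a0 atau] wa e.
have k'tau : k' * a <= r0.
  by apply: (@le_trans _ _ (k' * tau)); [rewrite ler_wpM2l // ltW | rewrite ktau ge_min lexx orbT].
apply: subset_closure; exists (eta u) => //; split.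
  by apply: (le_trans wa); apply: (le_trans atau); rewrite ge_min lexx.
by rewrite e !lerD2l k'tau andbT ler_wpM2l // ltW.
Qed.


End Deformation.

(** * Admissible maps and minimax values *)

Section Admissible.
Context {R : realType} {V : normedModType R}.
Implicit Types (Q : set V) (eta g : V -> V).

(** The relative boundary is closed in the topology of the hull and contained in the hull, which is
    itself closed in [V]. *)
Lemma closed_rel_boundary Q : closed (rel_boundary Q).
Proof.
set A := closed_affine_hull Q.
have cA : closed A by apply: closed_bigI => C [].
have QA : Q `<=` A by move=> x Qx C [_ _]; apply.
pose Q' : set (subspace A) := Q.
have QB : closed (closure Q' `\` interior Q').
  apply: closedI; first exact: closed_closure.
  by apply: open_closedC; exact: open_interior.
have subA : rel_boundary Q `<=` A.
  move=> x [cx _]; have : closure (A : set (subspace A)) x by apply: closure_subset cx.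
  by rewrite -(closure_id _).1 //; exact: closed_subspaceT.
have /closed_subspaceP[C cC CA] := QB.
rewrite (_ : rel_boundary Q = C `&` A); first exact: closedI.
by rewrite CA; apply/esym/setIidPl.
Qed.

Lemma homeomorphism_closed_image eta : homeomorphism eta ->
  forall A : set V, closed A -> closed (eta @` A).
Proof.
move=> [_ [h [ch etaK hK]]] A cA; rewrite (_ : eta @` A = h @^-1` A).
  by apply: closed_comp => // x _; exact: ch.
apply/seteqP; split => [_ [x Ax <-]|y Ay] /=; first by rewrite etaK.
by exists (h y).
Qed.

Lemma compact_map_comp eta g : continuous eta -> compact_map g ->
  compact_map (eta \o g).
Proof.
move=> ceta [cg gK]; split; first by move=> x; apply: continuous_comp; [exact: cg | exact: ceta].
move=> B /gK; rewrite !precompactE => cK.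
have ceK : compact (eta @` closure (g @` B)).
  by apply: continuous_compact => //; exact: continuous_subspaceT.
apply: (subclosed_compact _ ceK); first exact: closed_closure.
have /closure_id -> : closed (eta @` closure (g @` B)).
  by apply: compact_closed => //; exact: norm_hausdorff.
apply: closure_subset => _ [x Bx <-]; exists (g x) => //.
by apply: subset_closure; exists x.
Qed.

Lemma admissible_comp Q (Gamma : set (V -> V)) eta g :
  [\/ Gamma = Gamma1 Q, Gamma = Gamma2 Q, Gamma = Gamma3 Q
    | Gamma = Gamma4 Q \/ Gamma = Gamma5 Q] ->
  homeomorphism eta -> fixes (rel_boundary Q) eta -> Gamma g -> Gamma (eta \o g).
Proof.
move=> GammaE eta_homeo eta_fix.
have [ceta [h [ch etaK hK]]] := eta_homeo.
have fix_comp g' : fixes (rel_boundary Q) g' -> fixes (rel_boundary Q) (eta \o g').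
  by move=> fg u Bu /=; rewrite fg // eta_fix.
have cont_comp g' : continuous g' -> continuous (eta \o g').
  by move=> cg x; apply: continuous_comp; [exact: cg | exact: ceta].
case: GammaE => [->|->|->|[->|->]].
- by move=> [cg fg]; split; [exact: cont_comp | exact: fix_comp].
- by move=> [cg fg]; split; [exact: compact_map_comp | exact: fix_comp].
- move=> [[cg [k [ck gK kK]]] fg]; split; last exact: fix_comp.
  split; first exact: cont_comp.
  exists (k \o h); split.
  + by move=> x; apply: continuous_comp; [exact: ch | exact: ck].
  + by move=> x /=; rewrite etaK gK.
  + by move=> x /=; rewrite kK hK.
- move=> [cg clg fg]; split; [exact: compact_map_comp | | exact: fix_comp].
  by move=> A /clg cA; rewrite -image_comp; exact: homeomorphism_closed_image.
move=> [[cg fg] Bg]; split; first by split; [exact: cont_comp | exact: fix_comp].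
move=> B cB bB; rewrite -image_comp; apply: continuous_compact; last exact: Bg.
exact: continuous_subspaceT.
Qed.

End Admissible.

(** * From the Palais-Smale condition to a uniform slope *)

Section PalaisSmale.
Context {R : realType} {V : normedModType R}.
Variable Phi : V -> R.
Hypothesis Phi_C1 : C1 Phi.

Lemma increasing_seq_ge (s : nat -> nat) n : increasing_seq s -> (n <= s n)%N.
Proof.
move=> inc; elim: n => // n IH.
apply: (leq_ltn_trans IH); rewrite ltn_neqAle.
have := inc n n.+1; rewrite !leEnat leqnSn => ->.
rewrite andbT; apply/eqP => e; have := inc n.+1 n; rewrite !leEnat e leqnn ltnn.
by [].
Qed.

(** If every [k = 1 / (n + 1)] failed, the counterexamples would form a Palais-Smale sequence whose
    distance to [S] tends to 0; the limit of a subsequence would be a critical point at level [c] in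
    [S]. *)
Lemma palais_smale_slope (S : set V) (c : R) : closed S -> palais_smale Phi c ->
  critical_points_at Phi c `&` S = set0 ->
  exists2 k, 0 < k & forall u, `|Phi u - c| <= k ->
    (exists2 s, S s & `|u - s| <= 2 * k) ->
    exists2 v, `|v| <= 1 & k < 'd Phi u v.
Proof.
move=> cS PS KS; apply: contrapT => no_slope.
have dPhi x : differentiable Phi x by case: Phi_C1.
have H n : exists u : V, [/\ `|Phi u - c| <= n.+1%:R^-1,
    exists s, S s /\ `|u - s| <= 2 * n.+1%:R^-1 &
    forall v, `|v| <= 1 -> `|'d Phi u v| <= n.+1%:R^-1].
  apply: contrapT => noH; apply: no_slope; exists (n.+1%:R^-1); first by rewrite invr_gt0.
  move=> u uc [s Ss us]; apply: contrapT => nov; apply: noH; exists u; split => //.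
    by exists s.
  (* The unit ball is symmetric, so the failure of a one-sided slope bounds the absolute value. *)
  move=> v v1; rewrite ler_norml; apply/andP; split.
    rewrite lerNl -linearN leNgt; apply/negP => lt; apply: nov.
    by exists (- v) => //; rewrite normrN.
  by rewrite leNgt; apply/negP => lt; apply: nov; exists v.
have [u uP] := choice H.
have Hw n : exists s, S s /\ `|u n - s| <= 2 * n.+1%:R^-1 by have [] := uP n.
have [w wP] := choice Hw.
have cvgh : (n.+1%:R^-1 : R) @[n --> \oo] --> (0 : R) by exact: cvg_harmonic.
have Phi_cvg : Phi (u n) @[n --> \oo] --> c.
  apply/cvgrPdist_le => e e0; move/cvgrPdist_le : cvgh => /(_ e e0).
  apply: filterS => n; rewrite sub0r normrN => le_e.
  have [+ _ _] := uP n; rewrite distrC => /le_trans; apply.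
  exact: le_trans (ler_norm _) le_e.
have norm_cvg : dual_norm ('d Phi (u n)) @[n --> \oo] --> 0.
  apply/cvgrPdist_le => e e0; move/cvgrPdist_le : cvgh => /(_ e e0).
  apply: filterS => n; rewrite !sub0r !normrN => le_e.
  have [_ _ dle] := uP n; have [C _ CP] := diff_bound (dPhi (u n)).
  rewrite ger0_norm; last by apply: le_trans (dual_norm_ge CP (v := 0) _) => //; rewrite normr0.
  apply: (@le_trans _ _ (n.+1%:R^-1)); last exact: le_trans (ler_norm _) le_e.
  apply: ge_sup; first by exists `|'d Phi (u n) 0|, 0 => //=; rewrite normr0.
  by move=> _ [v /= v1 <-]; exact: dle.
have [s s_inc us_cvg] := PS u Phi_cvg norm_cvg.
set l := lim (u \o s @ \oo) in us_cvg.
have invs n : (s n).+1%:R^-1 <= n.+1%:R^-1 :> R.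
  by rewrite lef_pV2 ?posrE // ler_nat ltnS increasing_seq_ge.
have cPhi := C1_continuous Phi_C1.
have Phil : Phi l = c.
  have h1 : Phi (u (s n)) @[n --> \oo] --> Phi l by exact: (cvg_comp _ _ us_cvg (cPhi l)).
  apply/eqP; rewrite -subr_eq0 -normr_le0.
  apply: (cvg_norm_le h1 (cvg_cst c) cvgh) => n.
  by have [+ _ _] := uP (s n) => /le_trans; apply.
have Sl : S l.
  apply: (closed_cvg S cS (u_ := w \o s) (F := \oo)).
    by apply: nearW => n; have [] := wP (s n).
  apply/cvgrPdist_le => e e0.
  have e4 : 0 < e / 4 by lra.
  move/cvgrPdist_le : cvgh => /(_ _ e4).
  move/cvgrPdist_le : us_cvg => /(_ _ e4); apply: filterS2 => n /= h1.
  rewrite sub0r normrN => /(le_trans (ler_norm _)) h2.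
  have [_ h3] := wP (s n); have h4 := invs n.
  apply: (le_trans (ler_distD (u (s n)) _ _)).
  apply: (@le_trans _ _ (e / 4 + 2 * n.+1%:R^-1)); last first.
    by move: (n.+1%:R^-1) h2 => q /=; lra.
  by apply: lerD => //; apply: (le_trans h3); rewrite ler_wpM2l.
(* On the unit ball the differential at [l] is bounded by its distance to those along the
   subsequence plus [1 / (n + 1)]; both vanish in the limit. *)
have dl1 v : `|v| <= 1 -> 'd Phi l v = 0.
  move=> v1; apply/eqP; rewrite -normr_le0.
  have h1 : dual_norm (fun h => 'd Phi (u (s n)) h - 'd Phi l h) @[n --> \oo] --> 0.
    exact: (cvg_comp _ _ us_cvg (proj2 Phi_C1 l)).
  have h2 : dual_norm (fun h => 'd Phi (u (s n)) h - 'd Phi l h) + n.+1%:R^-1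
      @[n --> \oo] --> (0 : R).
    by rewrite -[X in _ --> X]addr0; exact: cvgD.
  have c1 : `|'d Phi l v| @[_ --> \oo] --> `|'d Phi l v| by exact: cvg_cst.
  apply: (ler_cvg_to c1 h2); apply: nearW => n /=.
  have [_ _ /(_ v v1) h3] := uP (s n).
  rewrite -(subKr ('d Phi (u (s n)) v) ('d Phi l v)).
  apply: (le_trans (ler_normB _ _)); rewrite addrC; apply: lerD.
    exact: diff_dist_le.
  exact: le_trans h3 (invs n).
have : (critical_points_at Phi c `&` S) l.
  split=> //; split=> // h.
  have [->|h0] := eqVneq h 0; first by rewrite linear0.
  have hn : `|h| != 0 by rewrite normr_eq0.
  rewrite -[h](scalerKV hn) linearZ /= dl1 ?scaler0 //.
  by rewrite normrZ normfV normr_id mulVf.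
by rewrite KS.
Qed.

End PalaisSmale.

(** * Linking and the minimax level *)

Section Minimax.
Context {R : realType} {V : completeNormedModType R}.
Variables (Phi : V -> R) (Q : set V) (Gamma : set (V -> V)).
Hypotheses (Phi_C1 : C1 Phi)
  (Gamma_choice : [\/ Gamma = Gamma1 Q, Gamma = Gamma2 Q, Gamma = Gamma3 Q
        | Gamma = Gamma4 Q \/ Gamma = Gamma5 Q]).

(** Linking is applied to [eta \o g], which is again admissible: some [eta (g u)] lies in [S], so
    [Phi (g u)] reaches the raised level. *)
Lemma minimax_ge_deformation (S : set V) (b k r : R) : closed S ->
  S `&` rel_boundary Q = set0 ->
  (forall g, Gamma g -> (g @` Q) `&` S !=set0) ->
  (forall u, S u -> b <= Phi u) -> (forall u, rel_boundary Q u -> Phi u <= b) ->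
  0 < k -> 0 < r ->
  (forall u, b <= Phi u <= b + r -> (exists2 s, S s & `|u - s| <= 2 * r) ->
    exists2 v, `|v| <= 1 & k < 'd Phi u v) ->
  ((b + Num.min (k / 2 * r) r)%:E <= minimax Phi Q Gamma)%E.
Proof.
move=> cS SB link PhiS PhiB k0 r0 slope.
have [eta [eta_homeo eta_fix eta_up]] :=
  deformation Phi_C1 cS (@closed_rel_boundary _ _ Q) SB PhiS PhiB k0 r0 slope.
apply: le_ereal_inf_tmp => _ [g Gg <-].
have [_ [[u Qu <-] Su]] := link _ (admissible_comp Gamma_choice eta_homeo eta_fix Gg).
apply: (@le_trans _ _ (Phi (g u))%:E); first by rewrite lee_fin; exact: eta_up.
by apply: ereal_sup_ubound; exists u.
Qed.

End Minimax.

Theorem theorem1 (R : realType) (V : completeNormedModType R) (Phi : V -> R)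
    (S Q : set V) (Gamma : set (V -> V)) (alpha : R)
    (Phi_C1 : C1 Phi)
    (S_closed : closed S)
    (Gamma_choice :
      [\/ Gamma = Gamma1 Q, Gamma = Gamma2 Q, Gamma = Gamma3 Q
        | Gamma = Gamma4 Q \/ Gamma = Gamma5 Q])
    (linking : links Gamma S Q)
    (Phi_le_boundary : forall u, rel_boundary Q u -> Phi u <= alpha)
    (Phi_ge_S : forall u, S u -> alpha <= Phi u)
    (finite_sup : exists2 g0, Gamma g0 & (sup_along Phi Q g0 < +oo)%E) :
  exists c : R,
    minimax Phi Q Gamma = c%:E /\
    (palais_smale Phi c ->
      [/\ critical_value Phi c,
          alpha <= c &
          c = alpha -> critical_points_at Phi c `&` S !=set0]).
Proof.
have [SB link'] := linking.
have link g : Gamma g -> (g @` Q) `&` S !=set0.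
  move=> Gg; apply: link' => //.
  by case: Gamma_choice Gg => [->|->|->|[->|->]]; [case | case | case | case | case=> -[]].
have minimax_ge : (alpha%:E <= minimax Phi Q Gamma)%E.
  apply: le_ereal_inf_tmp => _ [g Gg <-].
  have [_ [[u Qu <-] Su]] := link g Gg.
  apply: (@le_trans _ _ (Phi (g u))%:E); first by rewrite lee_fin; exact: Phi_ge_S.
  by apply: ereal_sup_ubound; exists u.
have minimax_lt : (minimax Phi Q Gamma < +oo)%E.
  have [g0 Gg0 g0P] := finite_sup; apply: le_lt_trans g0P.
  by apply: ereal_inf_lbound; exists g0.
have [c cE] : exists c : R, minimax Phi Q Gamma = c%:E.
  by case: (minimax Phi Q Gamma) minimax_ge minimax_lt => // c _ _; exists c.
exists c; split=> // PS.
have ac : alpha <= c by move: minimax_ge; rewrite cE lee_fin.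
have at_alpha : c = alpha -> critical_points_at Phi c `&` S !=set0.
  move=> ca; apply/set0P/eqP => KS.
  have [k k0 slope] := palais_smale_slope Phi_C1 S_closed PS KS.
  have := @minimax_ge_deformation _ _ Phi Q Gamma Phi_C1 Gamma_choice S alpha k k
    S_closed SB link Phi_ge_S Phi_le_boundary k0 k0.
  rewrite cE ca lee_fin leNgt ltrDl lt_min k0 andbT mulr_gt0 ?divr_gt0 // => H.
  (* The conclusion of the deformation bound is by now the false statement [~~ true]; applying it
     leaves its slope hypothesis to be checked. *)
  suff : ~~ true by [].
  apply: H => u /andP[u1 u2]; apply: slope.
  by rewrite ca ger0_norm ?subr_ge0 // lerBlDl.
split=> //.
move: ac; rewrite le_eqVlt => /orP[/eqP ac|ac].
  by have [v [Kv _]] := at_alpha (esym ac); exists v.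
apply/set0P/eqP => K0.
(* With the whole space in place of [S], the slope bound holds throughout a level strip around
   [c]. *)
have KT : critical_points_at Phi c `&` setT = set0 by rewrite setIT.
have [k k0 slope] := palais_smale_slope Phi_C1 (@closedT V) PS KT.
pose r := Num.min k (c - alpha).
have r0 : 0 < r by rewrite lt_min k0 subr_gt0.
have rk : r <= k by rewrite ge_min lexx.
have rc : r <= c - alpha by rewrite ge_min lexx orbT.
pose e := Num.min (k / 2 * r) r.
have e0 : 0 < e by rewrite lt_min r0 andbT !mulr_gt0 // invr_gt0.
have er : e <= r by rewrite ge_min lexx orbT.
(* The gain [e] carries [b] strictly above [c], while [e <= c - alpha] keeps [b] strictly above
   [alpha], so that [{Phi >= b}] misses the relative boundary. *)
pose b := c - e / 2.
have ab : alpha < b by rewrite /b; lra.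
have cS' : closed [set u | b <= Phi u].
  by apply: closed_le_fun; [move=> ?; exact: cvg_cst | exact: C1_continuous].
have := @minimax_ge_deformation _ _ Phi Q Gamma Phi_C1 Gamma_choice
  [set u | b <= Phi u] b k r cS'.
rewrite cE lee_fin -/e leNgt (_ : c < b + e); last by rewrite /b; lra.
move=> H; suff : ~~ true by [].
apply: H => //.
- rewrite -subset0 => u [/= bu /Phi_le_boundary ua].
  by have := le_trans bu ua; rewrite leNgt ab.
(* An admissible image of [Q] missing [{Phi >= b}] would bound the minimax value by [b], which is
   below [c]. *)
- move=> g Gg; apply: contrapT => no.
  suff : (minimax Phi Q Gamma <= b%:E)%E by rewrite cE lee_fin /b; lra.
  apply: (@le_trans _ _ (sup_along Phi Q g)).
    by apply: ereal_inf_lbound; exists g.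
  apply: ge_ereal_sup => _ [u Qu <-]; rewrite lee_fin leNgt; apply/negP => bu.
  by apply: no; exists (g u); split; [exists u | exact: ltW].
- by move=> u /Phi_le_boundary ua; lra.
move=> u /andP[u1 u2] _; apply: slope; last first.
  by exists u => //; rewrite subrr normr0 mulr_ge0 // ltW.
rewrite ler_norml; apply/andP; split; rewrite /b in u1 u2; lra.
Qed.
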